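(* For each positive integer $n$, the number of V-shapes in the graph of $E_n(\alpha)$ (as a function of $\alpha$) is exactly $n-1$.
   Context: For $\alpha\in[-1,1]$ let $f(x;\alpha)=|x-\alpha|$, $x\in[-1,1]$. For a nonnegative integer $n$ let $\mathbb{P}_n$ be the space of real polynomials of degree at most $n$, $\|\cdot\|$ the uniform norm on $[-1,1]$, and $E_n(\alpha)=\min_{q\in\mathbb{P}_n}\|f(\cdot;\alpha)-q\|$. V-shapes: $E_n$ has a V-shape on $[a,b]$ if there is $c\in(a,b)$ such that $E_n$ is continuous on $[a,b]$, linear and decreasing on $[a,c]$, and linear and increasing on $[c,b]$. If $[a,b]$ is a maximal interval with this property, then $[a,b]$ (or the portion of the graph of $E_n$ over it) is called a V-shape of $E_n$. *)

(* Defs.v *)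
From HB Require Import structures.
From mathcomp Require Import all_boot all_order all_algebra.
From mathcomp Require Import all_classical all_reals all_analysis.
Set Implicit Arguments.
Unset Strict Implicit.
Unset Printing Implicit Defensive.
Import Order.TTheory GRing.Theory Num.Theory numFieldNormedType.Exports.
Local Open Scope classical_set_scope.
Local Open Scope ring_scope.

Section VShapes.
Variable R : realType.
Implicit Types (g E : R -> R) (a b c : R).

Definition unorm g : R := sup [set `|g x| | x in `[-1, 1]].

Definition fabs (alpha x : R) : R := `|x - alpha|.

Definition polyle (n : nat) : set {poly R} := [set q | (size q <= n.+1)%N].

(* The best-approximation error is attained, so this infimum is a minimum. *)
Definition En (n : nat) (alpha : R) : R :=
  inf [set unorm (fun x => fabs alpha x - q.[x]) | q in polyle n].

(* "Linear" in the sense of a straight-line graph. *)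
Definition affine_on g a b : Prop :=
  exists m k : R, forall x, x \in `[a, b] -> g x = m * x + k.

Definition decreasing_on g a b : Prop :=
  {in `[a, b] &, {homo g : x y / x < y >-> y < x}}.

Definition increasing_on g a b : Prop :=
  {in `[a, b] &, {homo g : x y / x < y}}.

(* E is only considered on [-1, 1], hence the first conjunct. *)
Definition has_vshape_on E a b : Prop :=
  (-1 <= a /\ b <= 1) /\
  exists c : R, [/\ c \in `]a, b[,
    {within `[a, b], continuous E},
    affine_on E a c /\ decreasing_on E a c &
    affine_on E c b /\ increasing_on E c b].

Definition is_vshape E a b : Prop :=
  has_vshape_on E a b /\
  forall a' b' : R, `[a, b] `<=` `[a', b'] -> has_vshape_on E a' b' ->
    a' = a /\ b' = b.

(* A V-shape [a, b] is encoded by the pair (a, b); since a < b this encoding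
   is one-to-one. *)
Definition vshapes E : set (R * R) := [set p | is_vshape E p.1 p.2].

End VShapes.

(* Main.v *)
(** Let [q] be a best approximation of [|x - c|] and [e = |x - c| - q].  Since
    [q'] equals [-1] at the interior extremal points of [e] left of [c] and [1]
    at those right of [c], Rolle's theorem shows that [e] has at most [n + 1] interior
    extremal points, [c] being one of them in the case of equality.  If [e] has
    [n + 3] extremal points in all, they alternate, and stretching [e] about
    [-1] or about [1] gives the error functions for nearby [c]: [E_n] is
    proportional to [1 + c] on the right and to [1 - c] on the left.  Otherwise
    a first order perturbation of [q] by a translation and a multiple of the
    polynomial vanishing at the interior extremal points shows that [E_n] has no
    sharp minimum at [c].  So the V-shapes correspond to the [c] with [n + 3]
    extremal points.  If [k] of them lie in [(-1, c)] then [0 < k < n], and [k]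
    determines [c]: after rescaling, the difference of two such error functions
    would be a polynomial of degree [n] with [n + 1] zeros.  Such a [c] exists
    for every [k] by connectedness: the set of [c] whose error function
    alternates at [n + 2] points, [c] included, at most [k] of them left of
    [c], and the set of those with more than [k] of them left of [c] are closed,
    nonempty and cover; at a common point the two alternations combine into
    one with [n + 3] points. *)

Require Import Defs.
From mathcomp Require Import all_boot all_order all_algebra.
From mathcomp Require Import all_classical all_reals all_analysis.
From mathcomp Require Import polyrcf ring lra zify.
Set Implicit Arguments.
Unset Strict Implicit.
Unset Printing Implicit Defensive.
Import Order.TTheory GRing.Theory Num.Theory numFieldNormedType.Exports.
Local Open Scope classical_set_scope.
Local Open Scope ring_scope.

(** * Polynomials *)

Section Polynomials.
Variable R : realType.
Implicit Types (p q d : {poly R}) (x : nat -> R) (a b c h : R) (s t : seq R).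

Definition increasing_upto x N := forall i, (i < N)%N -> x i < x i.+1.

Lemma increasing_upto_lt x N i j : increasing_upto x N ->
  (i < j)%N -> (j <= N)%N -> x i < x j.
Proof.
move=> xN; elim: j => // j IH; rewrite ltnS leq_eqVlt => /orP[/eqP->|ij] jN.
  exact: xN.
by apply: lt_trans (IH ij (ltnW jN)) _; apply: xN.
Qed.

Lemma increasing_upto_le x N i j : increasing_upto x N ->
  (i <= j)%N -> (j <= N)%N -> x i <= x j.
Proof.
move=> xN; rewrite leq_eqVlt => /orP[/eqP->//|ij] jN.
exact/ltW/(increasing_upto_lt xN).
Qed.

Lemma increasing_upto_uniq x N (s : seq nat) : increasing_upto x N ->
  uniq s -> {in s, forall i, (i <= N)%N} -> uniq (map x s).
Proof.
move=> xN us sN; rewrite map_inj_in_uniq // => i j iS jS xij.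
case: (ltngtP i j) => // ij.
  by have := increasing_upto_lt xN ij (sN _ jS); rewrite xij ltxx.
by have := increasing_upto_lt xN ij (sN _ iS); rewrite xij ltxx.
Qed.

(** Zero counting with weak signs. A zero [z] of [d] in the first gap is divided out, and minus the
    quotient alternates weakly at one point fewer. Weak signs allow for error functions that touch
    at an extremal point. *)
Lemma weak_alternation N d x : increasing_upto x N ->
  (forall i, (i <= N)%N -> 0 <= (-1) ^+ i * d.[x i]) -> (size d <= N)%N ->
  d = 0.
Proof.
elim: N d x => [|N IH] d x xN alt sd.
  by apply/eqP; rewrite -size_poly_leq0.
have x01 : x 0%N < x 1%N by apply: xN.
have d0 : 0 <= d.[x 0%N] by have := alt 0%N isT; rewrite expr0 mul1r.
have d1 : d.[x 1%N] <= 0.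
  by have := alt 1%N isT; rewrite expr1 mulN1r oppr_ge0.
have [|z zin rz] := @polyrcf.poly_ivt R d (x 0%N) (x 1%N) (ltW x01).
  exact: mulr_ge0_le0.
move: zin; rewrite in_itv /= => /andP[z0 z1].
have [//|dn0] := eqVneq d 0.
have /factor_theorem[g dE] := rz.
have gn0 : g != 0 by apply: contraNneq dn0 => g0; rewrite dE g0 mul0r.
have sg : (size (- g)%R <= N)%N.
  by move: sd; rewrite size_polyN dE size_Mmonic ?monicXsubC // size_XsubC addn2.
have dg y : d.[y] = g.[y] * (y - z) by rewrite dE hornerM hornerXsubC.
have altS i : (0 < i)%N -> (i <= N)%N -> 0 <= (-1) ^+ i * (- g).[x i.+1].
  move=> i0 iN; have := alt i.+1 iN; rewrite dg exprS hornerN.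
  have zx : z < x i.+1.
    by apply: (le_lt_trans z1); apply: (increasing_upto_lt xN).
  have -> : -1 * (-1) ^+ i * (g.[x i.+1] * (x i.+1 - z)) =
    (-1) ^+ i * (- g.[x i.+1]) * (x i.+1 - z) by ring.
  by rewrite pmulr_lge0 // subr_gt0.
suff : - g = 0 by move/eqP; rewrite oppr_eq0 (negbTE gn0).
(* For [z < x 1] the node [x 0] is dropped. For [z = x 1] the sign of the quotient at [x 1] is
   unknown, so [x 1] is dropped and [x 0] kept. *)
have [zx1|zx1] := ltP z (x 1%N).
  apply: (IH _ (x \o succn) _ _ sg); first by move=> i iN; apply: xN.
  case=> [_|i iN]; last exact: altS.
  rewrite expr0 mul1r hornerN oppr_ge0 /=.
  have := d1; rewrite dg pmulr_lle0 // subr_gt0 //.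
have zE : z = x 1%N by apply/eqP; rewrite eq_le zx1 z1.
apply: (IH _ (fun i => if i is i'.+1 then x i'.+2 else x 0%N) _ _ sg).
  case=> [|i] iN; last exact: xN.
  by apply: (increasing_upto_lt xN).
case=> [_|i iN]; last exact: altS.
rewrite expr0 mul1r hornerN oppr_ge0.
by have := d0; rewrite dg zE nmulr_lge0 // subr_lt0.
Qed.

Lemma rolle_seq p v a s : path <%R a s -> {in a :: s, forall y, p.[y] = v} ->
  exists t, [/\ size t = size s, uniq t, {in t, forall z, root p^`() z} &
    {in t, forall z, a < z < last a s}].
Proof.
elim: s a => [|b s IH] a /=; first by exists [::].
move=> /andP[ab bs] pv.
have [|z zab pz] := @poly_rolle R a b p ab.
  by rewrite !pv ?inE ?eqxx ?orbT.
have [|t [st ut rt lt_t]] := IH _ bs.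
  by move=> y ys; apply: pv; rewrite inE ys orbT.
move: zab; rewrite in_itv /= => /andP[az zb].
have bl : b <= last b s.
  rewrite lt_path_sortedE in bs; case/andP: bs => /allP bs _.
  by have := mem_last b s; rewrite inE => /orP[/eqP->//|/bs/ltW].
exists (z :: t); split => /=.
- by rewrite st.
- rewrite ut andbT; apply/negP => /lt_t/andP[bz _].
  by have := lt_trans zb bz; rewrite ltxx.
- by move=> y; rewrite inE => /orP[/eqP->|/rt//]; apply/rootP.
- move=> y; rewrite inE => /orP[/eqP->|/lt_t/andP[by_ ->]].
    by rewrite az (lt_le_trans zb bl).
  by rewrite andbT (lt_trans _ by_) // ab.
Qed.

(** The [maxn] covers [p = 0], where [p - v%:P] is a nonzero constant of size 1. *)
Lemma level_count p v s : p != v%:P -> uniq s -> {in s, forall y, p.[y] = v} ->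
  (size s < maxn (size p) 1)%N.
Proof.
move=> pv us ps; have pv0 : p - v%:P != 0 by rewrite subr_eq0.
apply: leq_trans (max_poly_roots pv0 _ us) _.
  by apply/allP => y /ps py; rewrite /root hornerD hornerN hornerC py subrr.
apply: leq_trans (size_polyD _ _) _; rewrite size_polyN geq_max leq_maxl /=.
by apply: leq_trans (size_polyC_leq1 _) (leq_maxr _ _).
Qed.

(* By Rolle, [k] solutions of [p = u] followed by [m] solutions of [p = v] give
   [(k - 1) + (m - 1)] roots of the derivative. *)
Lemma two_level_count n p u v c s : u != v -> (0 < n)%N -> (size p <= n)%N ->
  p != u%:P -> p != v%:P -> uniq s ->
  {in s, forall y, y < c /\ p.[y] = u \/ c < y /\ p.[y] = v} ->
  (size s <= n)%N /\
  (size s = n -> (exists2 y, y \in s & y < c) /\ (exists2 y, y \in s & c < y)).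
Proof.
move=> uv n0 sp pu pv us ps.
pose sl := sort <=%R [seq y <- s | y < c].
pose sr := sort <=%R [seq y <- s | ~~ (y < c)].
have ss : size s = (size sl + size sr)%N.
  by rewrite !size_sort !size_filter -(count_predC (fun y => y < c)).
have sl_ y : y \in sl -> y \in s /\ y < c.
  by rewrite mem_sort mem_filter => /andP[].
have sl_v y : y \in sl -> p.[y] = u.
  by move=> /sl_[ys yc]; case: (ps _ ys) => -[] // /(lt_trans yc); rewrite ltxx.
have sr_ y : y \in sr -> y \in s /\ c < y.
  rewrite mem_sort mem_filter => /andP[yc ys]; split => //.
  by case: (ps _ ys) => -[] // yc'; rewrite yc' in yc.
have sr_v y : y \in sr -> p.[y] = v.
  by move=> /sr_[ys yc]; case: (ps _ ys) => -[] // /(lt_trans yc); rewrite ltxx.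
have sl_s : sorted <%R sl.
  by rewrite sort_lt_sorted filter_uniq.
have sr_s : sorted <%R sr.
  by rewrite sort_lt_sorted filter_uniq.
have n_max : (maxn (size p) 1 <= n)%N by rewrite geq_max sp.
have cl := leq_trans (level_count pu (lt_sorted_uniq sl_s) sl_v) n_max.
have cr := leq_trans (level_count pv (lt_sorted_uniq sr_s) sr_v) n_max.
(* If one side is empty, the strict bound on the other side alone rules out the case of equality. *)
rewrite ss; case: sl sl_ sl_v sl_s cl {ss} => [|a l] sl_ sl_v sl_s cl /=.
  by split; [exact: ltnW|move: cr => /[swap]; rewrite add0n => ->; rewrite ltnn].
case: sr sr_ sr_v sr_s cr => [|b r] sr_ sr_v sr_s cr /=.
  by split; [rewrite addn0; exact: ltnW|
    move: cl => /[swap]; rewrite addn0 /= => ->; rewrite ltnn].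
split; last first.
  move=> _; split.
    by exists a; have [] := sl_ a (mem_head _ _).
  by exists b; have [] := sr_ b (mem_head _ _).
have [tl [stl utl rtl ltl]] := rolle_seq sl_s sl_v.
have [tr [str utr rtr ltr]] := rolle_seq sr_s sr_v.
have dp0 : p^`() != 0.
  apply/eqP => dp0; have [|z _ /eqP] := @poly_mvt R a b p.
    have [_ ac] := sl_ a (mem_head _ _).
    by have [_ cb] := sr_ b (mem_head _ _); apply: lt_trans cb.
  rewrite dp0 horner0 mul0r subr_eq0 (sl_v a) ?mem_head // (sr_v b) ?mem_head //.
  by rewrite eq_sym (negbTE uv).
have : (size (tl ++ tr) < size p^`())%N.
  apply: max_poly_roots => //.
    by apply/allP => z; rewrite mem_cat => /orP[/rtl|/rtr].
  rewrite cat_uniq utl utr andbT /=; apply/hasPn => z /ltr/andP[bz _].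
  apply/negP => /ltl/andP[_ zl]; have [_ cl'] := sl_ _ (mem_last a l).
  have [_ cb] := sr_ b (mem_head _ _).
  by have := lt_trans (lt_trans zl cl') (lt_trans cb bz); rewrite ltxx.
(* A nonzero polynomial has fewer roots than its size, and differentiation lowers the size: these
   two units make up for the two points lost in Rolle's theorem. *)
have := lt_size_deriv (p := p); rewrite -size_poly_eq0.
have p0 : p != 0 by apply: contraNneq dp0 => ->; rewrite deriv0.
move: p0; rewrite -size_poly_eq0; rewrite size_cat stl str => p0 /(_ p0).
lia.
Qed.

End Polynomials.

(** * The error function *)

Section ErrorFunction.
Variable R : realType.
Implicit Types (p q : {poly R}) (a b c h x y r eps : R).

Lemma horner_near p x eps : 0 < eps ->
  exists2 r, 0 < r & forall y, `|y - x| < r -> `|p.[y] - p.[x]| < eps.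
Proof.
move=> e0; have /cvgrPdist_lt/(_ _ e0)/nbhs_ballP[r /= r0 rp] :=
  @continuous_horner R p x.
by exists r => // y yx; rewrite distrC; apply: rp; rewrite /ball /= distrC.
Qed.

Definition err c q x : R := fabs c x - q.[x].

Lemma err_near c q x eps : 0 < eps ->
  exists2 r, 0 < r & forall y, `|y - x| < r -> `|err c q y - err c q x| < eps.
Proof.
move=> e0; have e20 : 0 < eps / 2 by rewrite divr_gt0.
have [r r0 rq] := horner_near q x e20.
exists (Num.min r (eps / 2)); first by rewrite lt_min r0.
move=> y; rewrite lt_min => /andP[/rq yq yx]; rewrite /err /fabs.
have -> : `|y - c| - q.[y] - (`|x - c| - q.[x]) =
  (`|y - c| - `|x - c|) - (q.[y] - q.[x]) by ring.
apply: le_lt_trans (ler_normB _ _) _.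
have := ler_dist_dist (y - c) (x - c).
have -> : y - c - (x - c) = y - x by ring.
by lra.
Qed.

Definition left_piece c q : {poly R} := c%:P - 'X - q.
Definition right_piece c q : {poly R} := 'X - c%:P - q.

Lemma err_left c q x : x <= c -> err c q x = (left_piece c q).[x].
Proof. by move=> xc; rewrite /err /fabs ler0_norm ?subr_le0 // !hornerE opprB. Qed.

Lemma err_right c q x : c <= x -> err c q x = (right_piece c q).[x].
Proof. by move=> xc; rewrite /err /fabs ger0_norm ?subr_ge0 // !hornerE. Qed.

Lemma deriv_left_piece c q : (left_piece c q)^`() = - 1 - q^`().
Proof. by rewrite /left_piece !derivB derivC derivX sub0r. Qed.

Lemma deriv_right_piece c q : (right_piece c q)^`() = 1 - q^`().
Proof. by rewrite /right_piece !derivB derivC derivX subr0. Qed.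

Lemma err_mvt_left c q x y : x < y -> y <= c -> exists z,
  x < z < y /\ err c q y - err c q x = (- 1 - q^`().[z]) * (y - x).
Proof.
move=> xy yc; have [z] := poly_mvt (left_piece c q) xy.
rewrite in_itv /= => zxy; rewrite deriv_left_piece !hornerE => E.
by exists z; rewrite !err_left ?(le_trans (ltW xy)) // /left_piece !hornerE.
Qed.

Lemma err_mvt_right c q x y : x < y -> c <= x -> exists z,
  x < z < y /\ err c q y - err c q x = (1 - q^`().[z]) * (y - x).
Proof.
move=> xy cx; have [z] := poly_mvt (right_piece c q) xy.
rewrite in_itv /= => zxy; rewrite deriv_right_piece !hornerE => E.
by exists z; rewrite !err_right ?(le_trans _ (ltW xy)) // /right_piece !hornerE.
Qed.

Lemma err_rolle_left c q x y : x < y -> y <= c -> err c q x = err c q y ->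
  exists z, x < z < y /\ q^`().[z] = -1.
Proof.
move=> xy yc e; have [z [zxy]] := err_mvt_left q xy yc.
rewrite e subrr => /esym/eqP; rewrite mulf_eq0 (subr_eq0 y) (gt_eqF xy) orbF.
by rewrite subr_eq0 => /eqP E; exists z; split => //; rewrite -E.
Qed.

Lemma err_rolle_right c q x y : x < y -> c <= x -> err c q x = err c q y ->
  exists z, x < z < y /\ q^`().[z] = 1.
Proof.
move=> xy yc e; have [z [zxy]] := err_mvt_right q xy yc.
rewrite e subrr => /esym/eqP; rewrite mulf_eq0 (subr_eq0 y) (gt_eqF xy) orbF.
by rewrite subr_eq0 => /eqP E; exists z; split => //; rewrite -E.
Qed.

Lemma local_max_deriv p x r : 0 < r ->
  (forall y, `|y - x| < r -> p.[y] <= p.[x]) -> p^`().[x] = 0.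
Proof.
move=> r0 pmax; have [//|d0] := eqVneq p^`().[x] 0.
have dp : 0 < `|p^`().[x]| by rewrite normr_gt0.
have [s s0 sp] := horner_near p^`() x dp.
pose t := Num.min r s / 2.
have t0 : 0 < t by rewrite divr_gt0 // lt_min r0.
have tm : t < Num.min r s by rewrite ltr_pdivrMr // ltr_pMr ?ltr1n // lt_min r0.
move: tm; rewrite lt_min => /andP[tr ts].
have [dx|dx] := ltP 0 (p^`().[x]).
  have [|z] := @poly_mvt R x (x + t) p; first by rewrite ltrDl.
  rewrite in_itv /= => /andP[xz zt] E.
  have := pmax (x + t); rewrite addrAC subrr add0r gtr0_norm // => /(_ tr).
  have := sp z; rewrite gtr0_norm ?subr_gt0 // (gtr0_norm dx).
  have zs : z - x < s by lra.
  by move=> /(_ zs); rewrite ltr_norml => /andP[pz _]; nra.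
have {}dx : p^`().[x] < 0 by rewrite lt_neqAle d0.
have [|z] := @poly_mvt R (x - t) x p; first by rewrite ltrBlDr ltrDl.
rewrite in_itv /= => /andP[zt xz] E.
have := pmax (x - t).
have -> : x - t - x = - t by ring.
rewrite normrN gtr0_norm // => /(_ tr).
have := sp z; rewrite distrC gtr0_norm ?subr_gt0 // (ltr0_norm dx).
have zs : x - z < s by lra.
by move=> /(_ zs); rewrite ltr_norml => /andP[_ pz]; nra.
Qed.

(** The interval is a parameter because error functions are later rescaled, which moves it away from
    [[-1, 1]]. *)
Definition bounded_err c q h a b := forall x, a <= x <= b -> `|err c q x| <= h.

Lemma extremum_deriv p h x r : 0 < r -> `|p.[x]| = h ->
  (forall y, `|y - x| < r -> `|p.[y]| <= h) -> p^`().[x] = 0.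
Proof.
move=> r0 px ph; have [p0|p0] := leP 0 p.[x].
  apply: (local_max_deriv r0) => y /ph; rewrite -px (ger0_norm p0).
  by apply: le_trans; rewrite ler_norm.
apply/eqP; rewrite -oppr_eq0 -hornerN -derivN; apply/eqP.
apply: (local_max_deriv r0) => y /ph; rewrite -px (ltr0_norm p0) !hornerN.
by rewrite ler_norml lerNl => /andP[].
Qed.

Lemma extremal_left c q h a b x : bounded_err c q h a b -> a < x < b ->
  x < c -> `|err c q x| = h -> q^`().[x] = -1.
Proof.
move=> bd /andP[ax xb] xc ex.
pose r := Num.min (x - a) (Num.min (b - x) (c - x)).
have r0 : 0 < r by rewrite !lt_min !subr_gt0 ax xb.
have := @extremum_deriv (left_piece c q) h x r r0.
rewrite -err_left ?(ltW xc) // => /(_ ex) H.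
have : (left_piece c q)^`().[x] = 0.
  apply: H => y; rewrite !lt_min !ltr_norml => /and3P[/andP[y1 y2] /andP[y3 y4] /andP[y5 y6]].
  by rewrite -err_left; [apply: bd|]; lra.
by rewrite deriv_left_piece !hornerE; lra.
Qed.

Lemma extremal_right c q h a b x : bounded_err c q h a b -> a < x < b ->
  c < x -> `|err c q x| = h -> q^`().[x] = 1.
Proof.
move=> bd /andP[ax xb] xc ex.
pose r := Num.min (x - a) (Num.min (b - x) (x - c)).
have r0 : 0 < r by rewrite !lt_min !subr_gt0 ax xb.
have := @extremum_deriv (right_piece c q) h x r r0.
rewrite -err_right ?(ltW xc) // => /(_ ex) H.
have : (right_piece c q)^`().[x] = 0.
  apply: H => y; rewrite !lt_min !ltr_norml => /and3P[/andP[y1 y2] /andP[y3 y4] /andP[y5 y6]].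
  by rewrite -err_right; [apply: bd|]; lra.
by rewrite deriv_right_piece !hornerE; lra.
Qed.

(* The kink of [`|x - c|] points downwards, so [c] is not a local maximum. *)
Lemma kink_not_max c q h a b : bounded_err c q h a b -> a < c < b ->
  err c q c != h.
Proof.
move=> bd /andP[ac cb]; apply/eqP => ec.
have [r r0 rq] := horner_near q^`() c (ltr01 : 0 < 1 :> R).
pose t := Num.min (r / 2) (Num.min (c - a) (b - c)).
have t0 : 0 < t by rewrite !lt_min !subr_gt0 ac cb divr_gt0.
have : t <= t by []; rewrite {2}/t !le_min => /and3P[tr ta tb].
have [||z1 [/andP[z1l z1r] E1]] := @err_mvt_left c q (c - t) c; [lra|lra|].
have [||z2 [/andP[z2l z2r] E2]] := @err_mvt_right c q c (c + t); [lra|lra|].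
have b1 : err c q (c - t) <= h by apply/(le_trans (ler_norm _))/bd; lra.
have b2 : err c q (c + t) <= h by apply/(le_trans (ler_norm _))/bd; lra.
(* Maximality at [c] forces the derivative of [q] to be at most -1 at [z1] and at least 1 at [z2],
   but both values are at distance less than 1 from its value at [c]. *)
have := rq z1; rewrite distrC gtr0_norm ?subr_gt0 // => /(_ ltac:(lra)).
have := rq z2; rewrite gtr0_norm ?subr_gt0 // => /(_ ltac:(lra)).
by rewrite !ltr_norml => /andP[u1 u2] /andP[u3 u4]; nra.
Qed.

End ErrorFunction.

(** * Alternation and extremal points *)

Ltac nat_lia :=
  repeat match goal with
  | H : ?T |- _ =>
    lazymatch T with
    | nat => fail
    | is_true (leq _ _) => fail
    | is_true (leq _ _ && leq _ _) => fail
    | @eq nat _ _ => fail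
    | _ => clear H
    end
  end; lia.

Section Alternation.
Variable R : realType.
Implicit Types (p q : {poly R}) (x : nat -> R) (a b c h y z : R) (s : seq R).

Lemma err_monotone c q y z : y <= z ->
  (q^`() = (-1)%:P -> err c q y <= err c q z) /\
  (q^`() = 1%:P -> err c q z <= err c q y).
Proof.
rewrite le_eqVlt => /orP[/eqP->//|yz].
have [w _ E] := poly_mvt q yz.
have := ler_dist_dist (y - c) (z - c).
have -> : y - c - (z - c) = y - z by ring.
rewrite (distrC y z) [X in _ <= X]gtr0_norm ?subr_gt0 // ler_norml => /andP[d1 d2].
by split => dq; move: E; rewrite dq hornerC /err /fabs; lra.
Qed.

(** In these cases one of the two pieces of the error is constant, and its extremal points cannot be
    counted as roots. *)
Definition flat q := q^`() = (-1)%:P \/ q^`() = 1%:P.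

Lemma not_flat_neq q : ~ flat q -> q^`() != (-1)%:P /\ q^`() != 1%:P.
Proof. by move=> nf; split; apply/eqP => dq; apply: nf; [left|right]. Qed.

(** Only the parity of the offset [k] matters: it makes the error [+ h] at index [k], and [- h] at
    index [j] when the offset is [j.+1]. *)
Definition alternates c q h x N k :=
  forall i, (i <= N)%N -> err c q (x i) = (-1) ^+ (i + k) * h.

(** For a flat [q] the error is monotone, whereas three alternation points show both a rise and a
    fall. *)
Lemma alternates_not_flat c q h x N k : 0 < h -> (1 < N)%N ->
  increasing_upto x N -> alternates c q h x N k -> ~ flat q.
Proof.
move=> h0 N1 xN alt.
have [m01 m01'] := err_monotone c q (ltW (xN 0%N (ltnW N1))).
have [m12 m12'] := err_monotone c q (ltW (xN 1%N N1)).
move: m01 m01' m12 m12'; rewrite !alt ?(ltnW N1) // !addSn !exprS add0n.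
by rewrite -signr_odd; case: (odd k) => m1 m2 m3 m4 [] dq;
  move: (m1) (m2) (m3) (m4);
  [move=> /(_ dq) + _ /(_ dq) + _| move=> _ /(_ dq) + _ /(_ dq) +|
   move=> /(_ dq) + _ /(_ dq) + _| move=> _ /(_ dq) + _ /(_ dq) +];
  rewrite ?expr1 ?expr0; lra.
Qed.

Lemma deriv_level_count n q c s : (0 < n)%N -> (size q <= n.+1)%N -> ~ flat q ->
  uniq s ->
  {in s, forall y, y < c /\ q^`().[y] = -1 \/ c < y /\ q^`().[y] = 1} ->
  (size s <= n)%N /\
  (size s = n -> (exists2 y, y \in s & y < c) /\ (exists2 y, y \in s & c < y)).
Proof.
move=> n0 sq nf us sc; have [q1 q2] := not_flat_neq nf.
apply: (two_level_count _ n0 _ q1 q2 us sc).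
  by rewrite lt_eqF //; lra.
have [->|q0] := eqVneq q 0; first by rewrite deriv0 size_poly0.
by rewrite -ltnS (leq_trans (lt_size_deriv q0)).
Qed.

Definition extremal c q h a b y := a < y < b /\ `|err c q y| = h.

Lemma extremal_level c q h a b y : bounded_err c q h a b ->
  extremal c q h a b y -> y != c ->
  y < c /\ q^`().[y] = -1 \/ c < y /\ q^`().[y] = 1.
Proof.
move=> bd [yab ey]; rewrite neq_lt => /orP[yc|cy].
  by left; split=> //; apply: (extremal_left bd yab yc ey).
by right; split=> //; apply: (extremal_right bd yab cy ey).
Qed.

(** Away from [c] the extremal points are solutions counted by [deriv_level_count], at most [n] of
    them; [c] adds at most one. *)
Lemma extremal_count n c q h a b s : (0 < n)%N -> (size q <= n.+1)%N ->
  ~ flat q -> bounded_err c q h a b -> uniq s ->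
  {in s, forall y, extremal c q h a b y} ->
  (size s <= n.+1)%N /\
  (size s = n.+1 -> [/\ c \in s, exists2 y, y \in s & y < c &
                       exists2 y, y \in s & c < y]).
Proof.
move=> n0 sq nf bd us es.
have us' := rem_uniq c us.
have [|le_n eq_n] := deriv_level_count (c := c) n0 sq nf us'.
  by move=> y; rewrite mem_rem_uniq // => /andP[/= yc /es /extremal_level]; apply.
have [cs|cs] := boolP (c \in s); last first.
  have ss : size (rem c s) = size s by rewrite rem_id.
  by rewrite ss in le_n; split; [exact: leqW|move=> ss'; rewrite ss' ltnn in le_n].
have ss : size s = (size (rem c s)).+1.
  by rewrite size_rem // prednK //; case: (s) cs.
split; first by rewrite ss.
rewrite ss => -[/eq_n[[y ys yc] [z zs cz]]].
by split=> //; [exists y => //; apply: mem_rem ys|exists z => //; apply: mem_rem zs].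
Qed.

Lemma path_not_between x N i j y : increasing_upto x N -> (i < N)%N ->
  (j <= N)%N -> x i < y < x i.+1 -> y != x j.
Proof.
move=> xN iN jN /andP[xy yx]; apply/eqP => yE; case: (leqP j i) => ij.
  by have := increasing_upto_le xN ij (ltnW iN); rewrite -yE leNgt xy.
by have := increasing_upto_le xN ij jN; rewrite -yE leNgt yx.
Qed.

Lemma alternates_step c q h x N k : (k < N.+1)%N ->
  (forall i, (i < N)%N -> err c q (x i.+1) = - err c q (x i)) ->
  err c q (x k) = - h -> alternates c q h x N k.+1.
Proof.
move=> kN step ek.
have E i : (i <= N)%N -> err c q (x i) = (-1) ^+ i * err c q (x 0%N).
  elim: i => [|i IH] iN; first by rewrite expr0 mul1r.
  by rewrite step // IH 1?ltnW // exprS; ring.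
move=> i iN; rewrite E //; have := E k kN; rewrite ek => /esym ek0.
have : err c q (x 0%N) = (-1) ^+ k * (- h).
  by rewrite -ek0 mulrA -expr2 sqrr_sign mul1r.
by move=> ->; rewrite addnS exprS exprD; ring.
Qed.

(** Since at most [n + 1] extremal points are interior, [n + 3] of them include both ends and, by
    the case of equality, [c] with others on either side. Two neighbours with equal errors would
    give, by Rolle's theorem, one solution too many. *)
Lemma extremal_points_corner n c q h x : (0 < n)%N -> (size q <= n.+1)%N ->
  ~ flat q -> 0 < h -> -1 < c < 1 -> bounded_err c q h (-1) 1 ->
  increasing_upto x n.+2 -> -1 <= x 0%N -> x n.+2 <= 1 ->
  (forall i, (i <= n.+2)%N -> `|err c q (x i)| = h) ->
  exists k, [/\ (0 < k < n)%N, x 0%N = -1, x n.+2 = 1, x k.+1 = c &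
    alternates c q h x n.+2 k].
Proof.
move=> n0 sq nf h0 c1 bd xn xl xr ex.
have ext i : (i <= n.+2)%N -> -1 < x i < 1 -> extremal c q h (-1) 1 (x i).
  by move=> iN xi; split=> //; apply: ex.
have inn i : (0 < i < n.+2)%N -> -1 < x i < 1.
  move=> /andP[i0 iN]; apply/andP; split.
    by apply: le_lt_trans xl _; apply: (increasing_upto_lt xn) => //; exact: ltnW.
  by apply: lt_le_trans _ xr; apply: (increasing_upto_lt xn).
pose s := map x (iota 1 n.+1).
have mem_s y : y \in s -> exists2 i, (0 < i < n.+2)%N & y = x i.
  by move=> /mapP[i]; rewrite mem_iota add1n => iN ->; exists i.
have us : uniq s.
  by apply: (increasing_upto_uniq xn (iota_uniq _ _)) => i; rewrite mem_iota; nat_lia.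
have es : {in s, forall y, extremal c q h (-1) 1 y}.
  by move=> _ /mem_s[i iN ->]; apply: ext (inn _ iN); nat_lia.
have ss : size s = n.+1 by rewrite size_map size_iota.
have [_ /(_ ss)[cs [y /mem_s[iy iyN ->] yc] [z /mem_s[iz izN ->] cz]]] :=
  extremal_count n0 sq nf bd us es.
have [i0 i0N cE] := mem_s _ cs.
have iy0 : (iy < i0)%N.
  rewrite ltnNge; apply/negP => le; move: yc; rewrite cE ltNge.
  by rewrite (increasing_upto_le xn le) //; nat_lia.
have iz0 : (i0 < iz)%N.
  rewrite ltnNge; apply/negP => le; move: cz; rewrite cE ltNge.
  by rewrite (increasing_upto_le xn le) //; nat_lia.
(* Otherwise [x 0], ..., [x n.+1] would be [n + 2] interior extremal points. *)
have xl' : x 0%N = -1.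
  apply/eqP; rewrite eq_le xl andbT leNgt; apply/negP => x0.
  have us' : uniq (map x (iota 0 n.+2)).
    by apply: (increasing_upto_uniq xn (iota_uniq _ _)) => i; rewrite mem_iota; nat_lia.
  have [|] := extremal_count n0 sq nf bd us'; last first.
    by rewrite size_map size_iota ltnn.
  move=> w /mapP[i]; rewrite mem_iota => iN ->; case: i iN => [|i] iN.
    apply: ext => //; rewrite x0 /=; apply: (lt_le_trans _ xr).
    by apply: (increasing_upto_lt xn).
  by apply: ext; [|apply: inn]; move: iN; clear; lia.
have xr' : x n.+2 = 1.
  apply/eqP; rewrite eq_le xr /= leNgt; apply/negP => x0.
  have us' : uniq (map x (iota 1 n.+2)).
    by apply: (increasing_upto_uniq xn (iota_uniq _ _)) => i; rewrite mem_iota; nat_lia.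
  have [|] := extremal_count n0 sq nf bd us'; last first.
    by rewrite size_map size_iota ltnn.
  move=> w /mapP[i]; rewrite mem_iota => iN ->.
  have [->|i2] := eqVneq i n.+2.
    apply: ext => //; rewrite x0 andbT; apply: (le_lt_trans xl).
    by apply: (increasing_upto_lt xn).
  by apply: ext; [|apply: inn]; move: iN i2; clear; lia.
have us' := rem_uniq c us.
have ss' : size (rem c s) = n by rewrite size_rem // ss.
(* The [n] interior points other than [c] already exhaust the bound of [deriv_level_count]. *)
have extra z' i : (i < n.+2)%N -> x i < z' < x i.+1 ->
    z' < c /\ q^`().[z'] = -1 \/ c < z' /\ q^`().[z'] = 1 -> False.
  move=> iN zi lz.
  have uz : uniq (z' :: rem c s).
    rewrite cons_uniq us' andbT; apply/negP => /mem_rem/mem_s[j jN zj].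
    have jN' : (j <= n.+2)%N by nat_lia.
    by have := path_not_between xn iN jN' zi; rewrite zj eqxx.
  have [|] := deriv_level_count (c := c) n0 sq nf uz; last by rewrite [size _]/= -/s ss' ltnn.
  move=> w; rewrite inE => /orP[/eqP->//|].
  rewrite mem_rem_uniq // => /andP[/= wc /es /extremal_level].
  exact.
have step i : (i < n.+2)%N -> err c q (x i.+1) = - err c q (x i).
  move=> iN; have [ee|] := eqVneq (err c q (x i)) (err c q (x i.+1)); last first.
    have := ex i (ltnW iN); have := ex i.+1 iN.
    by move=> <- /eqP; rewrite eqr_norm2 => /orP[->//|/eqP->]; rewrite opprK.
  case: (leqP i.+1 i0) => ii0.
    have xc : x i.+1 <= c by rewrite cE (increasing_upto_le xn ii0) //; nat_lia.
    have [z' [zx dz]] := err_rolle_left (xn i iN) xc ee.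
    case: (extra z' i iN zx); left; split => //.
    by apply: lt_le_trans xc; case/andP: zx.
  have xc : c <= x i by rewrite cE (increasing_upto_le xn (ii0 : (i0 <= i)%N)) //; nat_lia.
  have [z' [zx dz]] := err_rolle_right (xn i iN) xc ee.
  case: (extra z' i iN zx); right; split => //.
  by apply: le_lt_trans xc _; case/andP: zx.
have i01 : i0 = (i0.-1).+1 by rewrite prednK //; nat_lia.
(* The point [x 0 = -1] is not counted, so [i0 - 1] points lie in [(-1, c)]. The offset [i0 + 1]
   given by [alternates_step] has the same parity. *)
exists i0.-1; rewrite -i01; split=> //; first nat_lia.
have ec : err c q (x i0) = - h.
  have := ex i0 ltac:(nat_lia); rewrite -cE => /eqP; rewrite eqr_norml.
  rewrite (negbTE (kink_not_max bd c1)) /= => /andP[/eqP-> _] //.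
have := alternates_step (N := n.+2) (k := i0) ltac:(nat_lia) step ec.
move=> alt i iN; rewrite (alt i iN) [in RHS]i01 /= i01 !addnS !exprS.
by rewrite -i01; ring.
Qed.

(** If [c] were missing, the [n] interior points would exhaust the bound of [deriv_level_count], and
    [c] would lie between two neighbours with opposite errors. Rolle's theorem or the intermediate
    value theorem then yields one more solution between them. *)
Lemma alternates_index n c q h x k : (0 < n)%N -> (size q <= n.+1)%N ->
  0 < h -> -1 < c < 1 -> bounded_err c q h (-1) 1 ->
  increasing_upto x n.+1 -> -1 <= x 0%N -> x n.+1 <= 1 ->
  alternates c q h x n.+1 k ->
  exists j, [/\ (j <= n.+1)%N, x j = c & alternates c q h x n.+1 j.+1].
Proof.
move=> n0 sq h0 c1 bd xn xl xr alt.
have nf := alternates_not_flat h0 (n0 : (1 < n.+1)%N) xn alt.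
have ex i : (i <= n.+1)%N -> `|err c q (x i)| = h.
  by move=> iN; rewrite alt // normrM normr_sign mul1r gtr0_norm.
have step i : (i < n.+1)%N -> err c q (x i.+1) = - err c q (x i).
  by move=> iN; rewrite !alt ?(ltnW iN) // addSn exprS; ring.
have [[j jN xj]|noc] := pselect (exists2 j, (j <= n.+1)%N & x j = c).
  exists j; split=> //; apply: alternates_step => //.
  have := ex j jN; rewrite xj => /eqP; rewrite eqr_norml.
  by rewrite (negbTE (kink_not_max bd c1)) /= => /andP[/eqP-> _].
exfalso.
have inn i : (0 < i < n.+1)%N -> -1 < x i < 1.
  move=> /andP[i0 iN]; apply/andP; split.
    by apply: le_lt_trans xl _; apply: (increasing_upto_lt xn) => //; exact: ltnW.
  by apply: lt_le_trans _ xr; apply: (increasing_upto_lt xn).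
have lev i : (0 < i < n.+1)%N ->
    x i < c /\ q^`().[x i] = -1 \/ c < x i /\ q^`().[x i] = 1.
  move=> iN; apply: (extremal_level bd); first by split; [exact: inn|apply: ex; nat_lia].
  by apply/eqP => xc; apply: noc; exists i => //; nat_lia.
pose s := map x (iota 1 n).
have mem_s y : y \in s -> exists2 i, (0 < i < n.+1)%N & y = x i.
  by move=> /mapP[i]; rewrite mem_iota add1n => iN ->; exists i.
have us : uniq s.
  by apply: (increasing_upto_uniq xn (iota_uniq _ _)) => i; rewrite mem_iota; nat_lia.
have ss : size s = n by rewrite size_map size_iota.
have [|_ /(_ ss)[[y /mem_s[iy iyN ->] yc] [z /mem_s[iz izN ->] cz]]] :=
  deriv_level_count (c := c) n0 sq nf us.
  by move=> _ /mem_s[i iN ->]; exact: lev.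
(* The last index [j] with [x j < c]. Interior points lie on both sides of [c], so [x j] and
   [x j.+1] are interior. *)
pose P i := `[< x i < c >] && (i <= n)%N.
have Piy : exists i, P i by exists iy; apply/andP; split; [exact/asboolP|nat_lia].
have Pb i : P i -> (i <= n)%N by case/andP.
case: (ex_maxnP Piy Pb) => j /andP[/asboolP xj jn] jmax.
have iyj : (iy <= j)%N by apply: jmax; apply/andP; split; [exact/asboolP|nat_lia].
have jiz : (j < iz)%N.
  rewrite ltnNge; apply/negP => le; have := increasing_upto_le xn le.
  by move=> /(_ ltac:(nat_lia)); lra.
have cxj : c < x j.+1.
  rewrite ltNge le_eqVlt; apply/negP => /orP[/eqP xc|xc].
    by apply: noc; exists j.+1 => //; nat_lia.
  suff /jmax : P j.+1 by rewrite ltnn.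
  by apply/andP; split; [exact/asboolP|nat_lia].
have dj : q^`().[x j] = -1 by case: (lev j ltac:(nat_lia)) => -[] //; lra.
have dj1 : q^`().[x j.+1] = 1 by case: (lev j.+1 ltac:(nat_lia)) => -[] //; lra.
(* Any further solution strictly between [x j] and [x j.+1] is one too many. *)
have extra w c0 : x j < w < x j.+1 -> x j < c0 < x j.+1 ->
    w < c0 /\ q^`().[w] = -1 \/ c0 < w /\ q^`().[w] = 1 -> False.
  move=> wj /andP[jc0 c0j] lw.
  have uw : uniq (w :: s).
    rewrite cons_uniq us andbT; apply/negP => /mem_s[i iN wi].
    have iN' : (i <= n.+1)%N by nat_lia.
    have jN' : (j < n.+1)%N by nat_lia.
    by have := path_not_between xn jN' iN' wj; rewrite wi eqxx.
  have [|] := deriv_level_count (c := c0) n0 sq nf uw; last by rewrite [size _]/= -/s ss ltnn.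
  move=> v; rewrite inE => /orP[/eqP->//|/mem_s[i iN ->]].
  case: (leqP i j) => ij.
    have xij : x i <= x j by apply: (increasing_upto_le xn); nat_lia.
    left; split; first lra.
    by case: (lev i iN) => -[] //; lra.
  have xij : x j.+1 <= x i by apply: (increasing_upto_le xn); nat_lia.
  right; split; first lra.
  by case: (lev i iN) => -[] //; lra.
have cj : x j < c < x j.+1 by rewrite xj cxj.
have := bd c; rewrite (ltW (andP c1).1) (ltW (andP c1).2) ler_norml => /(_ isT)/andP[cb _].
have ec : err c q c = - h \/ - h < err c q c.
  by move: cb; rewrite le_eqVlt => /orP[/eqP|]; [left|right].
have [ej|ej] : err c q (x j) = h \/ err c q (x j) = - h.
  by have := ex j ltac:(nat_lia) => /eqP; rewrite eqr_norml => /andP[/orP[]/eqP-> _]; [left|right].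
  have ej1 : err c q (x j.+1) = - h by rewrite step ?ej //; nat_lia.
  case: ec => ec.
    have [w [/andP[w1 w2] dw]] := err_rolle_right cxj (lexx c) (etrans ec (esym ej1)).
    by apply: (extra w c _ cj); [lra|right].
  (* The error falls from [c] to [x j.+1], so the derivative of [q] exceeds 1 at [u]; being -1 at
     [x j], it equals 1 at some [w] in between. As [w] may lie left of [c], the two levels are
     separated at the midpoint of [x j] and [w] instead of at [c]. *)
  have [u [/andP[u1 u2] E]] := err_mvt_right q cxj (lexx c).
  have du : 1 < q^`().[u] by nra.
  have [||w] := @polyrcf.poly_ivtoo R (q^`() - 1%:P) (x j) u; [lra|rewrite !hornerE dj; nra|].
  rewrite in_itv /= => /andP[w1 w2]; rewrite /root !hornerE subr_eq0 => /eqP dw.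
  by apply: (extra w ((x j + w) / 2)); [lra|lra|right; split=> //; lra].
have ej1 : err c q (x j.+1) = h by rewrite step ?ej ?opprK //; nat_lia.
case: ec => ec.
  have [w [/andP[w1 w2] dw]] := err_rolle_left xj (lexx c) (etrans ej (esym ec)).
  by apply: (extra w c _ cj); [lra|left].
have [u [/andP[u1 u2] E]] := err_mvt_left q xj (lexx c).
have du : q^`().[u] < -1 by nra.
have [||w] := @polyrcf.poly_ivtoo R (q^`() + 1%:P) u (x j.+1); [lra|rewrite !hornerE dj1; nra|].
rewrite in_itv /= => /andP[w1 w2]; rewrite /root !hornerE addr_eq0 => /eqP dw.
by apply: (extra w ((x j.+1 + w) / 2)); [lra|lra|left; split=> //; lra].
Qed.

End Alternation.

(** * Best approximation *)

Section BestApproximation.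
Variables (R : realType) (n : nat).
Implicit Types (p q : {poly R}) (x : nat -> R) (a b c h y z : R).

Lemma err_continuous c q : continuous (err c q).
Proof.
move=> x; apply/cvgrPdist_lt => eps /(err_near c q x)[r r0 rP].
apply/nbhs_ballP; exists r => //= y; rewrite /ball /= distrC => /rP.
by rewrite distrC.
Qed.

Lemma unorm_err_max c q :
  (forall y, -1 <= y <= 1 -> `|err c q y| <= unorm (err c q)) /\
  exists2 y, -1 <= y <= 1 & `|err c q y| = unorm (err c q).
Proof.
have [||y yin ymax] := @EVT_max R (fun y => `|err c q y|) (-1) 1; first lra.
  apply: (@continuous_subspaceT _ _ _ (fun y => `|err c q y|)) => x.
  apply: (@continuous_comp _ _ _ (err c q) (fun z : R => `|z|)).
    exact: err_continuous.
  exact: norm_continuous.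
have y1 : -1 <= y <= 1 by move: yin; rewrite in_itv.
have ub : ubound [set `|err c q x| | x in `[-1, 1]] `|err c q y|.
  by move=> _ [x xin <-]; apply: ymax.
have mem z : -1 <= z <= 1 -> [set `|err c q x| | x in `[-1, 1]] `|err c q z|.
  by move=> z1; exists z => //=; rewrite in_itv.
have le z : -1 <= z <= 1 -> `|err c q z| <= unorm (err c q).
  by move=> z1; apply: ub_le_sup; [exists (`|err c q y|)|exact: mem].
split=> //; exists y => //; apply/eqP; rewrite eq_le le //=.
by apply: ge_sup => //; exists (`|err c q y|); apply: mem.
Qed.

Lemma unorm_err_le c q h : bounded_err c q h (-1) 1 -> unorm (err c q) <= h.
Proof. by move=> bd; have [_ [y y1 <-]] := unorm_err_max c q; apply: bd. Qed.

Lemma unorm_err_ge0 c q : 0 <= unorm (err c q).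
Proof. by have [_ [y _ <-]] := unorm_err_max c q. Qed.

Lemma En_le c q h : (size q <= n.+1)%N -> bounded_err c q h (-1) 1 ->
  En n c <= h.
Proof.
move=> sq bd; apply: le_trans (unorm_err_le bd); apply: ge_inf.
  by exists 0 => _ [p _ <-]; exact: unorm_err_ge0.
by exists q.
Qed.

Lemma En_ge c h :
  (forall q h', (size q <= n.+1)%N -> bounded_err c q h' (-1) 1 -> h <= h') ->
  h <= En n c.
Proof.
move=> H; apply: lb_le_inf.
  by exists (unorm (err c 0)); exists 0 => //=; rewrite /polyle /= size_poly0.
move=> _ [q sq <-]; apply: (H q _ sq) => y y1.
by have [+ _] := unorm_err_max c q; apply.
Qed.

(** Polynomials of degree at most [n] are encoded by their values at these [n + 1] points of
    [[0, 1)], which makes compactness of boxes of row vectors available. *)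
Definition node (l : nat) : R := l%:R / n.+1%:R.

Lemma node_inj : injective node.
Proof.
move=> i j /eqP; rewrite eqr_div ?pnatr_eq0 // -!natrM eqr_nat eqn_mul2r.
by move=> /eqP.
Qed.

Lemma node_bound (i : 'I_n.+1) : -1 <= node i <= 1.
Proof.
have n0 : 0 < n.+1%:R :> R by rewrite ltr0n.
apply/andP; split.
  by apply: le_trans (_ : 0 <= _); [lra|rewrite divr_ge0 // ltW].
by rewrite ler_pdivrMr // mul1r ler_nat ltnW.
Qed.

Definition basis (i : 'I_n.+1) : {poly R} := tnth (lagrange n.+1 node) i.

Definition interp (v : 'rV[R]_n.+1) : {poly R} :=
  \sum_(i < n.+1) (v ord0 i)%:P * basis i.

Lemma size_interp v : (size (interp v) <= n.+1)%N.
Proof.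
apply: leq_trans (size_sum _ _ _) _; apply/bigmax_leqP => i _; rewrite mul_polyC.
by apply: leq_trans (size_scale_leq _ _) _; rewrite size_lagrange_ //; exact: node_inj.
Qed.

Lemma interpK q : (size q <= n.+1)%N -> interp (\row_i q.[node i]) = q.
Proof.
move=> sq; rewrite [RHS](lagrange_gen (x := node) _ node_inj sq) //.
by apply: eq_bigr => i _; rewrite mxE.
Qed.

Lemma horner_interp v y : (interp v).[y] = \sum_(i < n.+1) v ord0 i * (basis i).[y].
Proof. by rewrite horner_sum; apply: eq_bigr => i _; rewrite hornerM hornerC. Qed.

Section Continuity.
Variable T : topologicalType.
Implicit Types (f g : T -> R).

Lemma err_interp_continuous f g (v : T -> 'rV[R]_n.+1) :
  continuous f -> continuous g -> continuous v ->
  continuous (fun t => err (f t) (interp (v t)) (g t)).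
Proof.
move=> cf cg cv; rewrite /err /fabs.
under eq_fun do rewrite horner_interp.
move=> t; apply: cvgB.
  by apply: cvg_norm; apply: cvgB; [exact: cg|exact: cf].
apply: cvg_big => [|i _]; first exact: add_continuous.
apply: cvgM.
  apply: (@continuous_comp _ _ _ v (fun M => M ord0 i)); first exact: cv.
  exact: coord_continuous.
apply: (@continuous_comp _ _ _ g (horner (basis i))); first exact: cg.
exact: continuous_horner.
Qed.

Lemma closed_le_fun f g : continuous f -> continuous g ->
  closed [set t | f t <= g t].
Proof.
move=> cf cg.
have -> : [set t | f t <= g t] = (fun t => g t - f t) @^-1` [set y | 0 <= y].
  by apply/seteqP; split => t /=; rewrite subr_ge0.
apply: preimage_closed (@closed_ge _ 0) => t _.
by apply: cvgB; [exact: cg|exact: cf].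
Qed.

Lemma closed_eq_fun f g : continuous f -> continuous g ->
  closed [set t | f t = g t].
Proof.
move=> cf cg.
have -> : [set t | f t = g t] = [set t | f t <= g t] `&` [set t | g t <= f t].
  by apply/seteqP; split=> t /= => [->|[fg gf]] //; apply/eqP; rewrite eq_le fg.
by apply: closedI; apply: closed_le_fun.
Qed.

Lemma closed_bounded_err f g (v : T -> 'rV[R]_n.+1) :
  continuous f -> continuous g -> continuous v ->
  closed [set t | bounded_err (f t) (interp (v t)) (g t) (-1) 1].
Proof.
move=> cf cg cv.
have cst_y y : continuous (fun _ : T => y : R) by move=> t; exact: cvg_cst.
apply: (@closed_bigI _ _ [set y | -1 <= y <= 1]
  (fun y => [set t | `|err (f t) (interp (v t)) y| <= g t])) => y _.
apply: closed_le_fun => // t; apply: cvg_norm.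
exact: (err_interp_continuous cf (cst_y y) cv).
Qed.

End Continuity.

Definition box m (l u : R) : set 'rV[R]_m := [set v | forall i, `[l, u]%classic (v ord0 i)].

Lemma box_compact m l u : compact (@box m l u).
Proof.
apply: (@rV_compact R m (fun=> `[l, u]%classic)) => _; exact: segment_compact.
Qed.

(** The bound 4 adds the bound 2 for [fabs c] on [[-1, 1]] to the bound 2 for the error. *)
Lemma bounded_err_node c q h i : -1 <= c <= 1 -> h <= 2 ->
  bounded_err c q h (-1) 1 -> -4 <= q.[node i] <= 4 \/ ~ (i < n.+1)%N.
Proof.
move=> c1 h2 bd; have [iN|] := pselect (i < n.+1)%N; [left|by right].
have nb := node_bound (Ordinal iN); have := bd _ nb.
rewrite /err /fabs /= !ler_norml; rewrite /= in nb.
by have [] := lerP 0 (node i - c) => s; rewrite ?(ger0_norm s) ?(ltr0_norm s); lra.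
Qed.

Lemma sample_box c q h : -1 <= c <= 1 -> h <= 2 ->
  bounded_err c q h (-1) 1 -> box (-4) 4 (\row_(i < n.+1) q.[node i]).
Proof.
move=> c1 h2 bd i; rewrite mxE /= in_itv /=.
by have [] := bounded_err_node i c1 h2 bd => // -[]; exact: ltn_ord.
Qed.

Lemma zero_bounded c : -1 <= c <= 1 -> bounded_err c 0 2 (-1) 1.
Proof.
move=> c1 y y1; rewrite /err /fabs horner0 subr0 normr_id ler_norml; lra.
Qed.

Lemma En_le2 c : -1 <= c <= 1 -> En n c <= 2.
Proof. by move=> /zero_bounded; apply: En_le; rewrite size_poly0. Qed.

(** The level [h] is minimized over a compact set of pairs of a level and a vector of samples.
    Levels up to 2 suffice because the zero polynomial has error at most 2. *)
Lemma En_attained c : -1 <= c <= 1 ->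
  exists2 q : {poly R}, (size q <= n.+1)%N & bounded_err c q (En n c) (-1) 1.
Proof.
move=> c1.
pose A : set (R * 'rV[R]_n.+1) := `[0, 2]%classic `*` box (-4) 4.
pose B : set (R * 'rV[R]_n.+1) := [set t | bounded_err c (interp t.2) t.1 (-1) 1].
have c_fst : continuous (fst : R * 'rV[R]_n.+1 -> R) by move=> t; exact: cvg_fst.
have c_snd : continuous (snd : R * 'rV[R]_n.+1 -> _) by move=> t; exact: cvg_snd.
have cB : closed B.
  by apply: (closed_bounded_err _ c_fst c_snd) => t; exact: cvg_cst.
have cA : compact (A `&` B).
  apply: compact_closedI => //.
  by apply: compact_setX; [exact: segment_compact|exact: box_compact].
have mem (q : {poly R}) h : (size q <= n.+1)%N -> bounded_err c q h (-1) 1 -> h <= 2 ->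
    (A `&` B) (h, \row_(i < n.+1) q.[node i]).
  move=> sq bd h2; split; last by rewrite /B /= interpK.
  split; last exact: sample_box bd.
  rewrite /= in_itv /= h2 andbT; apply: le_trans (bd 0 _); first exact: normr_ge0.
  lra.
have [||t tin tmin] := @compact_EVT_min _ R fst _ _ cA.
- by exists (2, \row_(i < n.+1) (0 : {poly R}).[node i]); apply: mem;
    rewrite ?size_poly0 //; exact: zero_bounded.
- exact: continuous_subspaceT.
move: tin; rewrite inE => -[[tA _] tB].
have tE : t.1 = En n c.
  apply/eqP; rewrite eq_le; apply/andP; split; last first.
    exact: En_le (size_interp _) tB.
  apply: En_ge => q h sq bd; have [h2|h2] := leP h 2.
    by apply: (tmin (h, _)); rewrite inE; apply: mem sq bd h2.
  by move: tA; rewrite /= in_itv /= => /andP[_ t2]; lra.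
by exists (interp t.2); [exact: size_interp|rewrite -tE].
Qed.

Lemma En_ge0 c : 0 <= En n c.
Proof.
apply: En_ge => q h _ bd; apply: le_trans (bd 0 _); first exact: normr_ge0.
lra.
Qed.

(** An error function vanishing on [[-1, 1]] would attain its upper bound 0 at the kink. *)
Lemma En_gt0 c : -1 < c < 1 -> 0 < En n c.
Proof.
move=> c1; have c1' : -1 <= c <= 1 by lra.
have [q sq bd] := En_attained c1'.
rewrite lt_neqAle En_ge0 andbT; apply/eqP => e0; rewrite -e0 in bd.
have := bd c c1'; rewrite normr_le0 => ec.
by have := kink_not_max bd c1; rewrite ec.
Qed.

(* [x |-> 1 - c x] interpolates [|x - c|] at [-1] and [1]; shifting it down
   halves the maximal error, which is attained at [c]. *)
Lemma En_le_chord c : (0 < n)%N -> -1 <= c <= 1 -> En n c <= (1 - c ^+ 2) / 2.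
Proof.
move=> n0 c1; pose q : {poly R} := ((1 + c ^+ 2) / 2)%:P - c *: 'X.
apply: (@En_le _ q) => [|y y1].
  apply: leq_trans (size_polyD _ _) _; rewrite geq_max size_polyN.
  rewrite (leq_trans (size_polyC_leq1 _)) //=.
  by apply: leq_trans (size_scale_leq _ _) _; rewrite size_polyX.
rewrite /err /fabs /q !hornerE ler_norml.
by have [s|s] := lerP 0 (y - c); rewrite ?(ger0_norm s) ?(ltr0_norm s);
  apply/andP; split; nra.
Qed.

(** The errors at the ends keep [q.[1] - q.[-1]] within [2 * En n c], hence within [1 - c ^+ 2], of
    [-2 * c]. For a flat [q] this difference would be 2 or -2. *)
Lemma best_not_flat c q : (0 < n)%N -> -1 < c < 1 ->
  bounded_err c q (En n c) (-1) 1 -> ~ flat q.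
Proof.
move=> n0 c1 bd; have c1' : -1 <= c <= 1 by lra.
have ch := En_le_chord n0 c1'.
have e1 := bd (-1) ltac:(lra); have e2 := bd 1 ltac:(lra).
have [z _ E] := @poly_mvt R (-1) 1 q ltac:(lra).
have n1 : `|-1 - c| = 1 + c by rewrite ler0_norm; lra.
have n2 : `|1 - c| = 1 - c by rewrite ger0_norm; lra.
move: e1 e2; rewrite /err /fabs n1 n2 !ler_norml => e1 e2.
by case=> dq; move: E; rewrite dq hornerC; nra.
Qed.

(** If [p] had a smaller error, [p - q] would alternate strictly at [n + 2] points, although its
    degree is at most [n]. *)
Lemma de_la_vallee_poussin c q h x k : (size q <= n.+1)%N ->
  increasing_upto x n.+1 -> -1 <= x 0%N -> x n.+1 <= 1 ->
  alternates c q h x n.+1 k -> h <= En n c.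
Proof.
move=> sq xn xl xr alt; apply: En_ge => p h' sp bd.
have [//|hh] := leP h h'; have h'0 : 0 <= h'.
  by apply: le_trans (bd 0 _); [exact: normr_ge0|lra].
have d i : (i <= n.+1)%N -> 0 < (-1) ^+ i * ((-1) ^+ k * (p - q).[x i]).
  move=> iN; have xi : -1 <= x i <= 1.
    by rewrite (le_trans xl) ?(le_trans _ xr) // (increasing_upto_le xn).
  have := bd _ xi; have := alt _ iN; rewrite /err => E1 E2.
  have -> : (p - q).[x i] = (-1) ^+ (i + k) * h - err c p (x i).
    by rewrite -E1 hornerD hornerN /err; ring.
  rewrite mulrA -exprD mulrBr mulrA -expr2 sqrr_sign mul1r subr_gt0.
  apply: le_lt_trans hh; apply: le_trans E2; apply: le_trans (ler_norm _) _.
  by rewrite normrM normr_sign mul1r.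
have : (-1) ^+ k *: (p - q) = 0.
  apply: (weak_alternation xn) => [i iN|].
    by rewrite hornerZ; exact/ltW/d.
  apply: leq_trans (size_scale_leq _ _) _; apply: leq_trans (size_polyD _ _) _.
  by rewrite size_polyN geq_max sp.
by move=> pq0; have := d 0%N isT; rewrite -hornerZ pq0 horner0 mulr0 ltxx.
Qed.

(** The same comparison with weak signs. The competitor [p] is controlled only at the alternation
    points, so that it may come from another interval. *)
Lemma alternation_unique c q p h x k : (size q <= n.+1)%N ->
  (size p <= n.+1)%N -> increasing_upto x n.+1 -> alternates c q h x n.+1 k ->
  (forall i, (i <= n.+1)%N -> `|err c p (x i)| <= h) -> p = q.
Proof.
move=> sq sp xn alt bd; apply/eqP; rewrite -subr_eq0; apply/eqP.
suff : (-1) ^+ k *: (p - q) = 0.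
  by move/eqP; rewrite scaler_eq0 signr_eq0 /= => /eqP.
apply: (weak_alternation xn) => [i iN|]; last first.
  apply: leq_trans (size_scale_leq _ _) _; apply: leq_trans (size_polyD _ _) _.
  by rewrite size_polyN geq_max sp.
have := bd _ iN; have := alt _ iN; rewrite /err => E1 E2.
rewrite hornerZ.
have -> : (p - q).[x i] = (-1) ^+ (i + k) * h - err c p (x i).
  by rewrite -E1 hornerD hornerN /err; ring.
rewrite mulrA -exprD mulrBr mulrA -expr2 sqrr_sign mul1r subr_ge0.
apply: le_trans E2; apply: le_trans (ler_norm _) _.
by rewrite normrM normr_sign mul1r.
Qed.

End BestApproximation.

(** * Perturbation of a best approximation *)

Section Perturbation.
Variable R : realType.
Implicit Types (p q P : {poly R}) (x : nat -> R) (a b c h y z t r eps : R) (s : seq R).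

(** By compactness of [[-1, 1]], finitely many of the local radii suffice. *)
Lemma uniform_radius (A : R -> R -> Prop) :
  (forall x : R, -1 <= x <= 1 -> exists2 r, 0 < r &
    forall y t, -1 <= y <= 1 -> `|y - x| < r -> 0 < t < r -> A y t) ->
  exists2 r, 0 < r & forall y t, -1 <= y <= 1 -> 0 < t < r -> A y t.
Proof.
move=> loc; have : compact (`[-1, 1]%classic : set R) by exact: segment_compact.
move=> /compact_near_coveringP/(_ _ (0^'+ : set_system R)
  (fun t y => -1 <= y <= 1 -> A y t) _) [].
  move=> x; rewrite /= in_itv /= => /loc[r r0 rA].
  exists (ball x r, [set t | 0 < t < r]) => /=.
    split; first exact: nbhsx_ballx.
    apply: filterS2 (nbhs_right_gt (0 : R)) (nbhs_right_lt r0) => t /= -> ->//.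
  by move=> [y t] /= [xy tr] y1; apply: rA => //; move: xy; rewrite /ball /= distrC.
move=> r /= r0 rA; exists r => // y t y1 /andP[t0 tr].
have bt : ball 0 r t by rewrite /ball /= sub0r normrN gtr0_norm.
by apply: (rA t bt t0 y) => //=; rewrite in_itv.
Qed.

(** A longest duplicate-free list of elements of [A] contains them all. *)
Lemma finite_enumeration (A : R -> Prop) N :
  (forall s, uniq s -> {in s, forall y, A y} -> (size s <= N)%N) ->
  exists s, sorted <%R s /\ forall y, y \in s <-> A y.
Proof.
move=> bdA.
pose Q m := `[< exists s, [/\ uniq s, {in s, forall y, A y} & size s = m] >].
have Q0 : exists m, Q m by exists 0%N; apply/asboolP; exists [::].
have QN m : Q m -> (m <= N)%N by move=> /asboolP[s [us As <-]]; exact: bdA.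
case: (ex_maxnP Q0 QN) => m /asboolP[s [us As sm]] mmax.
exists (sort <=%R s); split; first by rewrite sort_lt_sorted.
move=> y; rewrite mem_sort; split; first exact: As.
move=> Ay; have [//|ys] := boolP (y \in s).
suff /mmax : Q m.+1 by rewrite ltnn.
apply/asboolP; exists (y :: s); split; rewrite /= ?ys ?sm //.
by move=> z; rewrite inE => /orP[/eqP->|/As].
Qed.

(** Either [g] changes sign at least [N] times along the list, or a polynomial with one root per
    sign change has the signs of [g]. The clause on [y <= a] carries the sign of [p] to the next
    point on the left in the induction. *)
Lemma alternation_or_separation (g : R -> R) N a s : path <%R a s ->
  {in a :: s, forall y, g y != 0} ->
  (exists x, [/\ increasing_upto x N, x 0%N = a,
     forall i, (i <= N)%N -> x i \in a :: s &
     forall i, (i <= N)%N -> 0 < (-1) ^+ i * (g a * g (x i))]) \/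
  (exists p, [/\ (size p <= N)%N, {in a :: s, forall y, 0 < p.[y] * g y} &
     forall y, y <= a -> 0 < p.[y] * g a]).
Proof.
elim: s a N => [|b s IH] a [|N] /= pth g0.
- left; exists (fun=> a); split=> // [i _|i]; first by rewrite mem_head.
  rewrite leqn0 => /eqP->; rewrite expr0 mul1r -expr2 exprn_even_gt0 //=.
  by apply: g0; exact: mem_head.
- right; exists (g a)%:P; have ga : 0 < g a * g a.
    by rewrite -expr2 exprn_even_gt0 //= g0 ?mem_head.
  split=> [|y|y _]; rewrite ?hornerC //.
    by apply: leq_trans (size_polyC_leq1 _) _.
  by rewrite inE => /eqP->.
- left; exists (fun=> a); split=> // [i _|i]; first by rewrite mem_head.
  rewrite leqn0 => /eqP->; rewrite expr0 mul1r -expr2 exprn_even_gt0 //=.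
  by apply: g0; exact: mem_head.
move: pth => /andP[ab bs].
have g0' : {in b :: s, forall y, g y != 0}.
  by move=> y ys; apply: g0; rewrite inE ys orbT.
have ga : g a != 0 by apply: g0; exact: mem_head.
have gb : g b != 0 by apply: g0'; exact: mem_head.
have ga2 : 0 < g a * g a by rewrite -expr2 exprn_even_gt0.
have gb2 : 0 < g b * g b by rewrite -expr2 exprn_even_gt0.
have trans u v : 0 < g a * g b -> 0 < u * g b * v -> 0 < u * g a * v.
  move=> gab ub; have : 0 < (u * g b * v) * (g a * g b) by rewrite mulr_gt0.
  have -> : (u * g b * v) * (g a * g b) = (u * g a * v) * (g b * g b) by ring.
  by rewrite pmulr_lgt0.
have transN u v : g a * g b < 0 -> 0 < u * g b * v -> 0 < - (u * g a * v).
  move=> gab ub; have : (u * g b * v) * (g a * g b) < 0 by rewrite pmulr_rlt0.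
  have -> : (u * g b * v) * (g a * g b) = - ((- (u * g a * v)) * (g b * g b)) by ring.
  by rewrite oppr_lt0 pmulr_lgt0.
have [gab|] := ltP 0 (g a * g b).
  case: (IH b N.+1 bs g0') => [[x [xN x0 xs xg]]|[p [sp ps pb]]].
    left; exists (fun i => if i is i'.+1 then x i else a); split=> //.
    - case=> [|i] iN; last exact: xN.
      by apply: lt_trans ab _; rewrite -x0; exact: xN.
    - case=> [|i] iN; first by rewrite mem_head.
      by rewrite inE xs // orbT.
    - case=> [|i] iN; first by rewrite expr0 mul1r.
      by have := xg _ iN; rewrite !mulrA; exact: trans.
  right; exists p; split=> // [y|y ya].
    rewrite inE => /orP[/eqP->|/ps //].
    by have := pb a (ltW ab); rewrite -[_ * g b]mulr1 -[_ * g a]mulr1; exact: trans.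
  have := pb y (le_trans ya (ltW ab)).
  by rewrite -[_ * g b]mulr1 -[_ * g a]mulr1; exact: trans.
rewrite le_eqVlt mulf_eq0 (negbTE ga) (negbTE gb) /= => gab.
case: (IH b N bs g0') => [[x [xN x0 xs xg]]|[p [sp ps pb]]].
  left; exists (fun i => if i is i'.+1 then x i' else a); split=> //.
  - case=> [|i] iN; last exact: xN.
    by rewrite x0.
  - case=> [|i] iN; first by rewrite mem_head.
    by rewrite inE xs // orbT.
  - case=> [|i] iN; first by rewrite expr0 mul1r.
    have := xg i iN; rewrite !mulrA => /(transN _ _ gab).
    by rewrite exprS mulN1r !mulNr.
(* The sign changes between [a] and [b]: a root is added in this gap. *)
have [z /andP[az zb]] : exists z, a < z < b by exists ((a + b) / 2); lra.
right; exists (('X - z%:P) * p).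
have below y : y <= a -> 0 < (('X - z%:P) * p).[y] * g a.
  move=> ya; rewrite hornerM hornerXsubC.
  have := pb y (le_trans ya (ltW ab)).
  rewrite -[_ * g b]mulr1 => /(transN _ _ gab); rewrite mulr1 => pa.
  have -> : (y - z) * p.[y] * g a = (z - y) * - (p.[y] * g a) by ring.
  by rewrite mulr_gt0 // subr_gt0; lra.
split=> // [|y].
  have [->|p0] := eqVneq p 0; first by rewrite mulr0 size_poly0.
  by rewrite size_monicM ?monicXsubC // size_XsubC add2n.
rewrite inE => /orP[/eqP->|yS]; first exact: below.
rewrite hornerM hornerXsubC -mulrA mulr_gt0 ?ps // subr_gt0.
apply: lt_le_trans zb _; move: yS; rewrite inE => /orP[/eqP->//|ys].
by rewrite lt_path_sortedE in bs; case/andP: bs => /allP/(_ _ ys)/ltW.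
Qed.

Lemma extremal_closed_count n c q h s : (0 < n)%N -> (size q <= n.+1)%N ->
  ~ flat q -> bounded_err c q h (-1) 1 -> uniq s ->
  {in s, forall y, -1 <= y <= 1 /\ `|err c q y| = h} -> (size s <= n.+3)%N.
Proof.
move=> n0 sq nf bd us es.
have us' := rem_uniq 1 (rem_uniq (-1) us).
have [|+ _] := extremal_count n0 sq nf bd us'.
  move=> y; rewrite mem_rem_uniq ?rem_uniq // => /andP[/= y1].
  rewrite mem_rem_uniq // => /andP[/= yn1 /es[y11 ey]]; split=> //.
  by rewrite !lt_neqAle y1 eq_sym yn1.
have le_rem (u : R) l : (size l <= (size (rem u l)).+1)%N.
  have [ul|ul] := boolP (u \in l); last by rewrite rem_id.
  by rewrite size_rem // prednK //; case: l ul.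
move=> le_n; apply: leq_trans (le_rem (-1) s) _; rewrite ltnS.
exact: leq_trans (le_rem 1 _) _.
Qed.

(** Chebyshev's alternation theorem. Without alternation, some [p] of degree at most [n] has the
    sign of the error at every extremal point, and adding a small multiple of [p] to [q] lowers the
    error below the minimum. *)
Lemma alternation_exists n c q : (0 < n)%N -> -1 < c < 1 -> (size q <= n.+1)%N ->
  bounded_err c q (En n c) (-1) 1 -> exists x k,
  [/\ increasing_upto x n.+1, -1 <= x 0%N, x n.+1 <= 1 &
      alternates c q (En n c) x n.+1 k].
Proof.
move=> n0 c1 sq bd; have nf := best_not_flat n0 c1 bd; have h0 := En_gt0 n c1.
set h := En n c in bd h0 *.
have [s [ss sE]] := @finite_enumeration
  (fun y => -1 <= y <= 1 /\ `|err c q y| = h) n.+3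
  (fun s => @extremal_closed_count n c q h s n0 sq nf bd).
have not_sep p : (size p <= n.+1)%N ->
    (forall y, -1 <= y <= 1 -> `|err c q y| = h -> 0 < p.[y] * err c q y) -> False.
  move=> sp psep.
  have [|r r0 rA] := @uniform_radius (fun y t => `|err c q y - t * p.[y]| < h).
    move=> x x1; have [r1 r10 r1P] := horner_near p x (ltr01 : 0 < 1 :> R).
    have M0 : 0 < `|p.[x]| + 1 by rewrite ltr_wpDl.
    have pM y : `|y - x| < r1 -> `|p.[y]| < `|p.[x]| + 1.
      move=> /r1P yp; rewrite -[p.[y]](subrK p.[x]).
      by apply: le_lt_trans (ler_normD _ _) _; rewrite addrC ltrD2l.
    have tM t y d : 0 < d -> `|y - x| < r1 -> 0 < t -> t < d / (`|p.[x]| + 1) ->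
        `|t * p.[y]| < d.
      move=> d0 /pM yp t0; rewrite ltr_pdivlMr // => td.
      rewrite normrM gtr0_norm //; apply: lt_trans td.
      by rewrite ltr_pM2l.
    have := bd x x1; rewrite le_eqVlt => /orP[/eqP ex|ex].
      (* Near an extremal point [p] keeps the sign of the error, the error stays within [h / 2] of
         its value at [x], and the correction is smaller than [h / 2]: subtracting it lowers the
         modulus. *)
      have pe := psep x x1 ex.
      have e0 : 0 < `|p.[x]| by rewrite normr_gt0; apply: contraTneq pe => ->; rewrite mul0r ltxx.
      have [r2 r20 r2P] := horner_near p x e0.
      have h2 : 0 < h / 2 by rewrite divr_gt0.
      have [r3 r30 r3P] := err_near c q x h2.
      exists (Num.min (Num.min r1 r2) (Num.min r3 (h / 2 / (`|p.[x]| + 1)))).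
        by rewrite !lt_min r10 r20 r30 !divr_gt0.
      move=> y t y1; rewrite !lt_min => /andP[/andP[yr1 yr2] /andP[yr3 _]].
      move=> /and3P[t0 /andP[_ _] /andP[_ tm]].
      have := tM t y _ h2 yr1 t0 tm; have := r2P y yr2; have := r3P y yr3.
      have := bd y y1; rewrite !ltr_norml !ler_norml.
      move=> /andP[b1 b2] /andP[e1 e2] /andP[p1 p2] /andP[t1 t2].
      move: ex => /eqP; rewrite eqr_norml => /andP[/orP[]/eqP ex _].
        have px : 0 < p.[x] by move: pe; rewrite ex pmulr_lgt0.
        move: p1; rewrite (gtr0_norm px) => p1.
        have tp : 0 < t * p.[y] by rewrite mulr_gt0 //; clear - p1; lra.
        by clear - tp b1 b2 e1 e2 t1 t2 ex; lra.
      have px : p.[x] < 0 by move: pe; rewrite ex mulrN oppr_gt0 pmulr_llt0.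
      move: p2; rewrite (ltr0_norm px) => p2.
      have tp : t * p.[y] < 0 by rewrite pmulr_rlt0 //; clear - p2; lra.
      by clear - tp b1 b2 e1 e2 t1 t2 ex; lra.
    (* Elsewhere the gap below [h] is shared between the variation of the error and the
       correction. *)
    have d0 : 0 < (h - `|err c q x|) / 2 by rewrite divr_gt0 // subr_gt0.
    have [r2 r20 r2P] := err_near c q x d0.
    exists (Num.min (Num.min r1 r2) ((h - `|err c q x|) / 2 / (`|p.[x]| + 1))).
      by rewrite !lt_min r10 r20 !divr_gt0 // subr_gt0.
    move=> y t y1; rewrite !lt_min => /andP[/andP[yr1 yr2] _] /and3P[t0 _ tm].
    have := tM t y _ d0 yr1 t0 tm; have := r2P y yr2.
    move=> e1 e2; apply: le_lt_trans (ler_normB _ _) _.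
    have e3 : `|err c q y| <= `|err c q y - err c q x| + `|err c q x|.
      by rewrite -{1}[err c q y](subrK (err c q x)) ler_normD.
    by clear - e1 e2 e3; lra.
  have t0 : 0 < r / 2 by rewrite divr_gt0.
  have [mx [y y1 ymx]] := unorm_err_max c (q + (r / 2) *: p).
  have : En n c <= unorm (err c (q + (r / 2) *: p)).
    apply: En_le mx; apply: leq_trans (size_polyD _ _) _; rewrite geq_max sq.
    by apply: leq_trans (size_scale_leq _ _) sp.
  rewrite -ymx leNgt; apply/negP; rewrite negbK.
  have -> : err c (q + (r / 2) *: p) y = err c q y - r / 2 * p.[y].
    by rewrite /err hornerD hornerZ opprD addrA.
  by apply: rA => //; lra.
case: s ss sE => [|a s] ss sE.
  case: (@not_sep 0); first by rewrite size_poly0.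
  by move=> y y1 ey; have /sE := conj y1 ey.
have g0 : {in a :: s, forall y, err c q y != 0}.
  by move=> y /sE[_ ey]; rewrite -normr_gt0 ey.
case: (alternation_or_separation n.+1 ss g0) => [[x [xN xa xs xg]]|[p [sp ps _]]].
  have [k ak] : exists k, err c q a = (-1) ^+ k * h.
    have /sE[_ /eqP] := mem_head a s; rewrite eqr_norml => /andP[/orP[]/eqP-> _].
      by exists 0%N; rewrite expr0 mul1r.
    by exists 1%N; rewrite expr1 mulN1r.
  have x1 i : (i <= n.+1)%N -> -1 <= x i <= 1 /\ `|err c q (x i)| = h.
    by move=> /xs/sE.
  exists x, k; split=> //.
  - by have [/andP[]] := x1 0%N isT.
  - by have [/andP[]] := x1 n.+1 (leqnn _).
  move=> i iN; have [_ ei] := x1 i iN; have := xg i iN; rewrite ak => gi.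
  have : 0 < (-1) ^+ (i + k) * err c q (x i).
    move: gi; have -> : (-1) ^+ i * ((-1) ^+ k * h * err c q (x i)) =
      ((-1) ^+ i * (-1) ^+ k * err c q (x i)) * h by ring.
    by rewrite -exprD pmulr_lgt0.
  move=> sgn; have := gtr0_norm sgn; rewrite normrM normr_sign mul1r ei => ->.
  by rewrite mulrA -expr2 sqrr_sign mul1r.
case: (not_sep p sp) => y y1 ey; apply: ps; exact/sE.
Qed.

Lemma poly_mvt_dist P y z : exists2 w, `|w - y| <= `|z - y| &
  P.[z] - P.[y] = P^`().[w] * (z - y).
Proof.
have [yz|zy|->] := ltgtP y z.
- have [w] := poly_mvt P yz; rewrite in_itv /= => /andP[yw wz] E.
  by exists w => //; rewrite !gtr0_norm ?subr_gt0 //; lra.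
- have [w] := poly_mvt P zy; rewrite in_itv /= => /andP[yw wz] E.
  by exists w => //; [rewrite !ltr0_norm ?subr_lt0 //; lra|lra].
- by exists z => //; rewrite !subrr mulr0.
Qed.

Lemma perturbation_piece c q h p P (w sg eps : R) : 0 < h -> 0 < eps ->
  sg = 1 \/ sg = -1 -> -1 <= w <= 1 -> `|err c q w| = h ->
  bounded_err c q h (-1) 1 ->
  (exists2 rho, 0 < rho & forall y, `|y - w| < rho -> err c q y = P.[y]) ->
  0 <= sg * (err c q w * (p.[w] + P^`().[w])) ->
  exists2 r, 0 < r & forall y t, -1 <= y <= 1 -> `|y - w| < r -> 0 < t < r ->
    `|err c q (y - sg * t) - sg * t * p.[y]| <= h + eps * t.
Proof.
move=> h0 eps0 sg1 w1 ew bd [rho rho0 eP] cond.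
have eps2 : 0 < eps / 2 by rewrite divr_gt0.
have h2 : 0 < h / 2 by rewrite divr_gt0.
have [r1 r10 r1P] := horner_near p w eps2.
have [r2 r20 r2P] := horner_near P^`() w eps2.
have [r3 r30 r3P] := err_near c q w h2.
have M0 : 0 < `|p.[w]| + eps by rewrite ltr_wpDl.
pose m := Num.min (Num.min rho r1) (Num.min r2 r3) / 2.
exists (Num.min m (h / 2 / (`|p.[w]| + eps))).
  by rewrite lt_min !divr_gt0 // !lt_min rho0 r10 r20.
move=> y t y1; rewrite !lt_min => /andP[ym _] /and3P[t0 tm].
rewrite ltr_pdivlMr // => tM.
have : m * 2 <= Num.min (Num.min rho r1) (Num.min r2 r3) by rewrite /m; lra.
rewrite !le_min => /andP[/andP[mrho mr1] /andP[mr2 mr3]].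
set z := y - sg * t.
have zy : `|z - y| = t.
  rewrite /z addrAC subrr add0r normrN normrM (gtr0_norm t0).
  by case: sg1 => ->; rewrite ?normrN normr1 mul1r.
have zw : `|z - w| < m * 2.
  have -> : z - w = (z - y) + (y - w) by ring.
  by apply: le_lt_trans (ler_normD _ _) _; clear - zy ym tm; lra.
have [v vy E] := poly_mvt_dist P y z.
have vw : `|v - w| < m * 2.
  have -> : v - w = (v - y) + (y - w) by ring.
  by apply: le_lt_trans (ler_normD _ _) _; clear - vy zy ym tm; lra.
have yw : `|y - w| < m * 2 by clear - t0 tm ym; lra.
have ez : err c q z = P.[z] by apply: eP; apply: lt_le_trans mrho.
have ey : err c q y = P.[y] by apply: eP; apply: lt_le_trans mrho.
have pd := r1P y (lt_le_trans yw mr1).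
have := pd; have := r2P v (lt_le_trans vw mr2); have := r3P z (lt_le_trans zw mr3).
have := bd y y1; rewrite ey ez.
have tp : `|t * p.[y]| < h / 2.
  rewrite normrM gtr0_norm //; apply: lt_trans tM; rewrite ltr_pM2l //.
  rewrite -[p.[y]](subrK p.[w]); apply: le_lt_trans (ler_normD _ _) _.
  by clear - pd eps0; lra.
move: tp; rewrite !ltr_norml !ler_norml => /andP[t1 t2] /andP[b1 b2].
move=> /andP[e1 e2] /andP[d1 d2] /andP[p1 p2].
have te : 0 < eps * t by rewrite mulr_gt0.
have zyE : z - y = - (sg * t) by rewrite /z; ring.
rewrite zyE in E.
have PzE : P.[z] = P.[y] - P^`().[v] * (sg * t) by clear - E; lra.
have slopes u : - eps < u -> - (eps * t) <= u * t.
  by move=> ul; rewrite -mulNr ler_pM2r // ltW.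
have nonneg u : 0 <= h * u -> 0 <= u by rewrite pmulr_rge0.
case: sg1 => sgE; rewrite ?sgE ?mul1r ?mulN1r in cond PzE *;
  move: ew => /eqP; rewrite eqr_norml => /andP[/orP[]/eqP ew _]; rewrite ew in cond e1 e2.
- have /nonneg cd := cond.
  have := slopes (P^`().[v] + p.[y]) ltac:(clear - cd d1 d2 p1 p2; lra); rewrite mulrDl => sl.
  by rewrite PzE in e1 e2 *; clear - sl b1 b2 e1 e2 t1 t2 te h0; apply/andP; split; lra.
- have /nonneg cd : 0 <= h * - (p.[w] + P^`().[w]) by rewrite mulrN -mulNr.
  have := slopes (- (P^`().[v] + p.[y])) ltac:(clear - cd d1 d2 p1 p2; lra); rewrite mulNr mulrDl => sl.
  by rewrite PzE in e1 e2 *; clear - sl b1 b2 e1 e2 t1 t2 te h0; apply/andP; split; lra.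
- have /nonneg cd : 0 <= h * - (p.[w] + P^`().[w]) by rewrite mulrN.
  have := slopes (- (P^`().[v] + p.[y])) ltac:(clear - cd d1 d2 p1 p2; lra); rewrite mulNr mulrDl => sl.
  by rewrite PzE in e1 e2 *; clear - sl b1 b2 e1 e2 t1 t2 te h0; apply/andP; split; lra.
- have /nonneg cd : 0 <= h * (p.[w] + P^`().[w]) by rewrite -[X in 0 <= X]opprK -mulNr.
  have := slopes (P^`().[v] + p.[y]) ltac:(clear - cd d1 d2 p1 p2; lra); rewrite mulrDl => sl.
  by rewrite PzE in e1 e2 *; clear - sl b1 b2 e1 e2 t1 t2 te h0; apply/andP; split; lra.
Qed.

(* The hypotheses say that the derivative in [t] at [0] of the perturbed error
   is not positive at the extremal points. *)
Lemma perturbation c q h p (sg eps : R) : 0 < h -> 0 < eps ->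
  sg = 1 \/ sg = -1 -> -1 < c < 1 -> bounded_err c q h (-1) 1 ->
  (forall y, extremal c q h (-1) 1 y -> p.[y] = 0) ->
  (forall w, w = -1 \/ w = 1 -> `|err c q w| = h ->
     0 <= sg * (err c q w * (p.[w] + (w - q^`().[w])))) ->
  exists2 r, 0 < r & forall y t, -1 <= y <= 1 -> 0 < t < r ->
    `|err c q (y - sg * t) - sg * t * p.[y]| <= h + eps * t.
Proof.
move=> h0 eps0 sg1 c1 bd pint pend; apply: uniform_radius => x x1.
have sgt t : 0 < t -> `|sg * t| = t.
  by move=> t0; rewrite normrM (gtr0_norm t0); case: sg1 => ->; rewrite ?normrN normr1 mul1r.
have shift y t : 0 < t -> `|y - sg * t - x| <= `|y - x| + t.
  move=> t0; rewrite -{2}(sgt t t0).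
  have -> : y - sg * t - x = (y - x) - sg * t by ring.
  exact: ler_normB.
have := bd x x1; rewrite le_eqVlt => /orP[/eqP ex|ex]; last first.
  have d0 : 0 < (h - `|err c q x|) / 2 by rewrite divr_gt0 // subr_gt0.
  have [r1 r10 r1P] := horner_near p x (ltr01 : 0 < 1 :> R).
  have [r2 r20 r2P] := err_near c q x d0.
  have M0 : 0 < `|p.[x]| + 1 by rewrite ltr_wpDl.
  exists (Num.min (Num.min r1 (r2 / 2)) ((h - `|err c q x|) / 2 / (`|p.[x]| + 1))).
    by rewrite !lt_min r10 !divr_gt0 // subr_gt0.
  move=> y t y1; rewrite !lt_min => /andP[/andP[yr1 yr2] _] /and3P[t0 /andP[_ tr2]].
  rewrite ltr_pdivlMr // => tM.
  have e1 := r2P (y - sg * t) ltac:(have := shift y t t0; lra).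
  apply: le_trans (ler_normB _ _) _.
  have e2 : `|err c q (y - sg * t)| <= `|err c q (y - sg * t) - err c q x| + `|err c q x|.
    by rewrite -{1}[err c q (y - _)](subrK (err c q x)) ler_normD.
  have e3 : `|sg * t * p.[y]| <= t * (`|p.[x]| + 1).
    rewrite normrM sgt // ler_pM2l // -[p.[y]](subrK p.[x]).
    by apply: le_trans (ler_normD _ _) _; have p1 := r1P y yr1; clear - p1; lra.
  have et : 0 < eps * t by rewrite mulr_gt0.
  by clear - e1 e2 e3 et ex tM; lra.
have [xl|xl] := eqVneq x (-1).
  have dl : (left_piece c q)^`().[x] = x - q^`().[x].
    by rewrite deriv_left_piece !hornerE xl.
  apply: (perturbation_piece (P := left_piece c q)) => //.
    exists (c - x); first by lra.
    by move=> y; rewrite ltr_norml => /andP[_ yc]; apply: err_left; lra.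
  by rewrite dl; apply: pend; [left|].
have [xr|xr] := eqVneq x 1.
  have dr : (right_piece c q)^`().[x] = x - q^`().[x].
    by rewrite deriv_right_piece !hornerE xr.
  apply: (perturbation_piece (P := right_piece c q)) => //.
    exists (x - c); first by lra.
    by move=> y; rewrite ltr_norml => /andP[yc _]; apply: err_right; lra.
  by rewrite dr; apply: pend; [right|].
have xin : -1 < x < 1 by rewrite !lt_neqAle eq_sym xl xr.
(* At an interior extremal point the translated error is still bounded by [h], and [p] is smaller
   than [eps] nearby. *)
have px0 : p.[x] = 0 by apply: pint.
have [r1 r10 r1P] := horner_near p x eps0.
exists (Num.min r1 (Num.min ((x + 1) / 2) ((1 - x) / 2))).
  by rewrite !lt_min r10 !divr_gt0 //; lra.
move=> y t y1; rewrite !lt_min => /and3P[yr1 yr2 yr3] /and3P[t0 _ /andP[t2 t3]].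
have := r1P y yr1; rewrite px0 subr0 => pe.
apply: le_trans (ler_normB _ _) _; apply: lerD.
  apply: bd; have := shift y t t0; rewrite ler_norml => /andP[s1 s2]; lra.
by rewrite normrM sgt // mulrC ler_pM2r // ltW.
Qed.

(* The error function alternates at [n + 3] points, [k] of which lie in
   [(-1, c)]. *)
Definition corner n k c := exists q h x,
  [/\ (size q <= n.+1)%N, 0 < h, bounded_err c q h (-1) 1,
      increasing_upto x n.+2 &
      [/\ x 0%N = -1, x n.+2 = 1, x k.+1 = c & alternates c q h x n.+2 k]].

(** With fewer than [n + 3] extremal points, some [p] and some direction [sg] satisfy the conditions
    of [perturbation], and [En n] grows by at most [d / 2 * t] in that direction, contradicting the
    slope [d]. *)
Lemma sharp_min_corner n c (d r0 : R) : (0 < n)%N -> -1 < c < 1 -> 0 < d ->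
  0 < r0 -> (forall t, `|t| < r0 -> En n c + d * `|t| <= En n (c + t)) ->
  exists2 k, (0 < k < n)%N & corner n k c.
Proof.
move=> n0 c1 d0 r00 sharp; have c1' : -1 <= c <= 1 by lra.
have [q sq bd] := En_attained n c1'.
have nf := best_not_flat n0 c1 bd; have h0 := En_gt0 n c1.
set h := En n c in sharp bd h0 *.
have no_pert p (sg : R) : (size p <= n.+1)%N -> sg = 1 \/ sg = -1 ->
    (forall y, extremal c q h (-1) 1 y -> p.[y] = 0) ->
    (forall w, w = -1 \/ w = 1 -> `|err c q w| = h ->
      0 <= sg * (err c q w * (p.[w] + (w - q^`().[w])))) -> False.
  move=> sp sg1 pint pend; have d2 : 0 < d / 2 by rewrite divr_gt0.
  have [r r_gt0 rP] := perturbation h0 d2 sg1 c1 bd pint pend.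
  pose t := Num.min r r0 / 2.
  have t0 : 0 < t by rewrite divr_gt0 // lt_min r_gt0.
  have : t < Num.min r r0 by rewrite ltr_pdivrMr // ltr_pMr ?ltr1n // lt_min r_gt0.
  rewrite lt_min => /andP[tr tr0].
  have sgt : `|sg * t| = t.
    by rewrite normrM (gtr0_norm t0); case: sg1 => ->; rewrite ?normrN normr1 mul1r.
  have := sharp (sg * t); rewrite sgt => /(_ tr0).
  (* The competitor at [c + sg * t]: translating [q] along with the kink leaves only the perturbed
     error to be estimated. *)
  pose q' := q \Po ('X - (sg * t)%:P) + (sg * t) *: p.
  have : En n (c + sg * t) <= h + d / 2 * t.
    apply: (@En_le _ _ _ q').
      apply: leq_trans (size_polyD _ _) _; rewrite geq_max size_comp_poly2 ?size_XsubC // sq.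
      exact: leq_trans (size_scale_leq _ _) sp.
    move=> y y1; have := rP y t y1; rewrite t0 => /(_ tr).
    rewrite /err /fabs /q' hornerD hornerZ horner_comp hornerXsubC.
    have -> : y - (c + sg * t) = y - sg * t - c by ring.
    by rewrite opprD addrA.
  have := mulr_gt0 d0 t0; lra.
have [s [ss sE]] := @finite_enumeration (extremal c q h (-1) 1) n.+1
  (fun s us es => (extremal_count n0 sq nf bd us es).1).
have us := lt_sorted_uniq ss.
have sgP (u : R) : exists2 sg : R, sg = 1 \/ sg = -1 & 0 <= sg * u.
  have [u0|u0] := leP 0 u; first by exists 1; [left|rewrite mul1r].
  by exists (-1); [right|rewrite mulN1r oppr_ge0 ltW].
have [sn _] := extremal_count n0 sq nf bd us (fun y => (sE y).1).
move: sn; rewrite leq_eqVlt => /orP[/eqP sn|sn]; last first.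
  pose P0 : {poly R} := \prod_(a <- s) ('X - a%:P).
  have P0_root y : (P0.[y] == 0) = (y \in s) by rewrite -rootE root_prod_XsubC.
  have P0l : P0.[-1] != 0 by rewrite P0_root; apply/negP => /sE[]; rewrite ltxx.
  have P0r : P0.[1] != 0 by rewrite P0_root; apply/negP => /sE[]; rewrite ltxx andbF.
  (* The factor makes the end condition at -1 an equality for either direction; [sg] is then chosen
     to satisfy the one at 1. *)
  pose p := (- (-1 - q^`().[-1]) / P0.[-1]) *: P0.
  have [sg sg1 sgr] := sgP (err c q 1 * (p.[1] + (1 - q^`().[1]))).
  exfalso; apply: (no_pert p sg) => //.
  - by apply: leq_trans (size_scale_leq _ _) _; rewrite size_prod_XsubC.
  - by move=> y /sE; rewrite -P0_root hornerZ => /eqP->; rewrite mulr0.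
  - move=> w [->|->] _ //; rewrite hornerZ divfK // addNr !mulr0 //.
(* With [n + 1] interior points, an end that is not extremal imposes no condition, and [p = 0] with
   a suitable [sg] satisfies the one at the other end. *)
have [el|el] := eqVneq `|err c q (-1)| h; last first.
  have [sg sg1 sgr] := sgP (err c q 1 * (1 - q^`().[1])).
  exfalso; apply: (no_pert 0 sg) => // [|y _|w]; rewrite ?size_poly0 ?horner0 //.
  by rewrite add0r => -[->|->] // /eqP; rewrite (negbTE el).
have [er|er] := eqVneq `|err c q 1| h; last first.
  have [sg sg1 sgr] := sgP (err c q (-1) * (-1 - q^`().[-1])).
  exfalso; apply: (no_pert 0 sg) => // [|y _|w]; rewrite ?size_poly0 ?horner0 //.
  by rewrite add0r => -[->|->] // /eqP; rewrite (negbTE er).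
pose l := -1 :: rcons s 1.
have sl : size l = n.+3 by rewrite /= size_rcons sn.
have lsort : sorted <%R l.
  rewrite /l /= rcons_path lt_path_sortedE ss andbT; apply/andP; split.
    by apply/allP => y /sE[/andP[]].
  by have := mem_last (-1) s; rewrite inE => /orP[/eqP->|/sE[/andP[]]] //; lra.
have lE y : y \in l -> -1 <= y <= 1 /\ `|err c q y| = h.
  rewrite /l inE mem_rcons inE => /or3P[/eqP->|/eqP->|/sE[/andP[y1 y2]]];
    split=> //; rewrite ?lexx //; lra.
pose x i := nth 0 l i.
have xl i : (i <= n.+2)%N -> x i \in l by move=> iN; rewrite mem_nth // sl.
have xn : increasing_upto x n.+2.
  by move=> i iN; move/(sortedP 0): lsort; apply; rewrite sl.
have x0 : x 0%N = -1 by [].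
have xr : x n.+2 <= 1 by have [/andP[]] := lE _ (xl n.+2 (leqnn _)).
have x0l : -1 <= x 0%N by rewrite x0.
have [k [kn _ xr' xk alt]] := extremal_points_corner n0 sq nf h0 c1 bd xn x0l xr
  (fun i iN => (lE _ (xl i iN)).2).
by exists k => //; exists q, h, x; split.
Qed.

End Perturbation.

(** * Corners *)

Section Corners.
Variables (R : realType) (n : nat).
Implicit Types (p q : {poly R}) (x : nat -> R) (a b c h y z : R).

Lemma size_comp_affine q a b : (size (q \Po (a *: 'X + b%:P)) <= size q)%N.
Proof.
have [->|q0] := eqVneq q 0; first by rewrite comp_poly0 size_poly0.
apply: leq_trans (size_comp_poly_leq _ _) _.
have s2 : (size (a *: 'X + b%:P : {poly R})%R <= 2)%N.
  apply: leq_trans (size_polyD _ _) _; rewrite geq_max.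
  rewrite (leq_trans (size_scale_leq _ _)) ?size_polyX //=.
  exact: leq_trans (size_polyC_leq1 _) _.
rewrite -[X in (_ <= X)%N](@prednK (size q)) ?size_poly_gt0 // ltnS.
by rewrite -[X in (_ <= X)%N]muln1 leq_mul2l; case: size s2 => [|[|[|]]] //; rewrite orbT.
Qed.

(* Stretching the error function about the point [u]. *)
Lemma En_stretch c q h x k (u s : R) : (size q <= n.+1)%N ->
  bounded_err c q h (-1) 1 -> increasing_upto x n.+1 ->
  alternates c q h x n.+1 k -> -1 <= u <= 1 -> 1 <= s ->
  -1 <= u + s * (x 0%N - u) -> u + s * (x n.+1 - u) <= 1 ->
  En n (u + s * (c - u)) = s * h.
Proof.
move=> sq bd xn alt u1 s1 xl xr; have s0 : 0 < s by lra.
pose q' := s *: (q \Po (s^-1 *: 'X + (u - s^-1 * u)%:P)).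
have sq' : (size q' <= n.+1)%N.
  by apply: leq_trans (size_scale_leq _ _) _; apply: leq_trans (size_comp_affine _ _ _) sq.
have errE y : err (u + s * (c - u)) q' (u + s * (y - u)) = s * err c q y.
  rewrite /err /fabs hornerZ horner_comp hornerD hornerZ hornerX hornerC [RHS]mulrBr.
  have -> : u + s * (y - u) - (u + s * (c - u)) = s * (y - c) by ring.
  rewrite normrM gtr0_norm //; congr (_ - _ * q.[_]).
  by field; rewrite gt_eqF.
(* Upper bound: since [s >= 1], the inverse of the stretching maps [[-1, 1]] into itself. Lower
   bound: the stretched alternation points stay in [[-1, 1]]. *)
apply/eqP; rewrite eq_le; apply/andP; split.
  apply: (En_le sq') => y y1.
  have -> : y = u + s * (u + (y - u) / s - u) by field; rewrite gt_eqF.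
  rewrite errE normrM gtr0_norm // ler_pM2l //; apply: bd.
  have si : 0 < s^-1 <= 1 by rewrite invr_gt0 s0 invf_le1.
  by apply/andP; split; nra.
apply: (@de_la_vallee_poussin _ _ _ _ _ (fun i => u + s * (x i - u)) k sq') => //.
  by move=> i iN; have := xn i iN; nra.
by move=> i iN; rewrite errE alt // mulrCA.
Qed.

Lemma increasing_upto_leq x m N : (m <= N)%N -> increasing_upto x N ->
  increasing_upto x m.
Proof. by move=> mN xN i im; apply: xN; exact: leq_trans im mN. Qed.

Lemma alternates_leq c q h x m N k : (m <= N)%N -> alternates c q h x N k ->
  alternates c q h x m k.
Proof. by move=> mN alt i im; apply: alt; exact: leq_trans im mN. Qed.

Lemma corner_bounds k c : (k < n)%N -> corner n k c -> -1 < c < 1.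
Proof.
move=> kn [q [h [x [_ _ _ xn [xl xr xk _]]]]]; rewrite -xl -xr -xk.
by rewrite !(increasing_upto_lt xn) //; nat_lia.
Qed.

(** Stretching about -1 is applied to [x 0], ..., [x n.+1], the last of which lies below 1 and
    leaves room; stretching about 1 is applied to [x 1], ..., [x n.+2]. The factors
    [(1 + y) / (1 + c)] and [(1 - y) / (1 - c)] carry [c] to [y]. *)
Lemma corner_lines k c : (k < n)%N -> corner n k c -> exists2 r, 0 < r &
  (forall y, c <= y <= c + r -> En n y = En n c / (1 + c) * (1 + y)) /\
  (forall y, c - r <= y <= c -> En n y = En n c / (1 - c) * (1 - y)).
Proof.
move=> kn cor; have c1 := corner_bounds kn cor.
case: cor => q [h [x [sq h0 bd xn [xl xr xk alt]]]].
have xn' := increasing_upto_leq (leqnSn _) xn.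
have alt' := alternates_leq (leqnSn _) alt.
have x1 : -1 < x 1%N by rewrite -xl; exact: xn.
have xn1 : x n.+1 < 1 by rewrite -xr; exact: xn.
have x11 : x 1%N < 1.
  by apply: le_lt_trans xn1; apply: (increasing_upto_le xn'); nat_lia.
have xn11 : -1 < x n.+1.
  by apply: lt_le_trans x1 _; apply: (increasing_upto_le xn'); nat_lia.
have right_E y : c <= y -> (1 + y) / (1 + c) * (x n.+1 + 1) <= 2 ->
    En n y = (1 + y) / (1 + c) * h.
  move=> cy yr; have c1p : 0 < 1 + c by lra.
  have := @En_stretch c q h x k (-1) ((1 + y) / (1 + c)) sq bd xn' alt'.
  have -> : -1 + (1 + y) / (1 + c) * (c - -1) = y by field; rewrite gt_eqF.
  apply; rewrite ?ler_pdivlMr ?xl ?subrr; lra.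
have left_E y : y <= c -> (1 - y) / (1 - c) * (1 - x 1%N) <= 2 ->
    En n y = (1 - y) / (1 - c) * h.
  move=> cy yr; have c1p : 0 < 1 - c by lra.
  have := @En_stretch c q h (x \o succn) k.+1 1 ((1 - y) / (1 - c)) sq bd.
  have -> : 1 + (1 - y) / (1 - c) * (c - 1) = y by field; rewrite gt_eqF.
  apply; rewrite ?ler_pdivlMr /= ?xr ?subrr; try lra.
    by move=> i iN; apply: xn.
  by move=> i iN; rewrite /= alt // addSnnS.
have Ec : En n c = h.
  have c0 : 1 + c != 0 by rewrite gt_eqF //; lra.
  by rewrite right_E ?lexx // divff // mul1r //; lra.
(* At the shift [r1] the image of [x n.+1] reaches 1; at the shift [r2] that of [x 1] reaches -1. *)
pose r1 := (2 / (x n.+1 + 1) - 1) * (1 + c).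
pose r2 := (2 / (1 - x 1%N) - 1) * (1 - c).
have r10 : 0 < r1 by rewrite mulr_gt0 // ?subr_gt0 ?ltr_pdivlMr; lra.
have r20 : 0 < r2 by rewrite mulr_gt0 // ?subr_gt0 ?ltr_pdivlMr; lra.
exists (Num.min r1 r2); first by rewrite lt_min r10.
have m1 : Num.min r1 r2 <= r1 by rewrite ge_min lexx.
have m2 : Num.min r1 r2 <= r2 by rewrite ge_min lexx orbT.
rewrite Ec; split=> y /andP[y1 y2].
  have yr : 1 + y <= (2 / (x n.+1 + 1)) * (1 + c).
    by move: (le_trans y2 (lerD (lexx c) m1)); rewrite /r1; lra.
  have {}yr : (1 + y) / (1 + c) * (x n.+1 + 1) <= 2.
    rewrite mulrAC ler_pdivrMr; last lra.
    apply: le_trans (ler_wpM2r _ yr) _; first lra.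
    by rewrite mulrAC divfK // gt_eqF //; lra.
  by rewrite (right_E _ y1 yr); field; rewrite gt_eqF //; lra.
have yr : 1 - y <= (2 / (1 - x 1%N)) * (1 - c) by move: y1 m2; rewrite /r2; lra.
have {}yr : (1 - y) / (1 - c) * (1 - x 1%N) <= 2.
  rewrite mulrAC ler_pdivrMr; last lra.
  apply: le_trans (ler_wpM2r _ yr) _; first lra.
  by rewrite mulrAC divfK // gt_eqF //; lra.
by rewrite (left_E _ y2 yr); field; rewrite gt_eqF //; lra.
Qed.

Lemma corner_En k c : (k < n)%N -> corner n k c -> exists q x,
  [/\ (size q <= n.+1)%N, bounded_err c q (En n c) (-1) 1,
      increasing_upto x n.+2 & [/\ x 0%N = -1, x n.+2 = 1, x k.+1 = c &
      alternates c q (En n c) x n.+2 k]].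
Proof.
move=> kn cor; have c1 := corner_bounds kn cor.
case: cor => q [h [x [sq h0 bd xn [xl xr xk alt]]]].
suff <- : h = En n c by exists q, x; split.
apply/eqP; rewrite eq_le (En_le sq bd) andbT.
apply: (de_la_vallee_poussin sq (increasing_upto_leq (leqnSn _) xn) _ _
  (alternates_leq (leqnSn _) alt)); first by rewrite xl.
by rewrite -xr; exact/ltW/xn.
Qed.

(** By uniqueness both alternations belong to one error function. The [k2] points left of [c] in one
    and the [n - k1] points right of [c] in the other exceed the bound [n]. *)
Lemma corner_index_lt k1 k2 c : (k1 < k2)%N -> (k2 < n)%N ->
  corner n k1 c -> corner n k2 c -> False.
Proof.
move=> k12 k2n cor1 cor2; have k1n := ltn_trans k12 k2n.
have c1 := corner_bounds k1n cor1; have h0 := En_gt0 n c1.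
have [q [x [sq bd xn [xl xr xk alt]]]] := corner_En k1n cor1.
have [q' [z [sq' bd' zn [zl zr zk alt']]]] := corner_En k2n cor2.
have qq : q' = q.
  apply: (alternation_unique sq sq' (increasing_upto_leq (leqnSn _) xn)
    (alternates_leq (leqnSn _) alt)) => i iN.
  apply: bd'; rewrite -xl -xr !(increasing_upto_le xn) //; nat_lia.
rewrite {}qq in bd' sq' alt'.
have nf := alternates_not_flat h0 (isT : (1 < n.+2)%N) xn alt.
have n0 : (0 < n)%N by nat_lia.
have ext y : -1 < y < 1 -> `|err c q y| = En n c -> y != c ->
    y < c /\ q^`().[y] = -1 \/ c < y /\ q^`().[y] = 1.
  by move=> y1 ey; apply: (extremal_level bd).
have sgn i k : `|(-1) ^+ (i + k) * En n c| = En n c.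
  by rewrite normrM normr_sign mul1r gtr0_norm.
pose s := map z (iota 1 k2) ++ map x (iota k1.+2 (n - k1)).
have sl y : y \in map z (iota 1 k2) -> y < c /\ q^`().[y] = -1.
  move=> /mapP[i]; rewrite mem_iota => iN ->.
  have zc : z i < c by rewrite -zk; apply: (increasing_upto_lt zn); nat_lia.
  have z1 : -1 < z i < 1.
    by apply/andP; split; [rewrite -zl; apply: (increasing_upto_lt zn); nat_lia|lra].
  have ez : `|err c q (z i)| = En n c by rewrite alt' ?sgn //; nat_lia.
  have zc' : z i != c by rewrite lt_eqF.
  by case: (ext _ z1 ez zc') => -[] //; lra.
have sr y : y \in map x (iota k1.+2 (n - k1)) -> c < y /\ q^`().[y] = 1.
  move=> /mapP[i]; rewrite mem_iota => iN ->.
  have xc : c < x i by rewrite -xk; apply: (increasing_upto_lt xn); nat_lia.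
  have x1 : -1 < x i < 1.
    by apply/andP; split; [lra|rewrite -xr; apply: (increasing_upto_lt xn); nat_lia].
  have ex : `|err c q (x i)| = En n c by rewrite alt ?sgn //; nat_lia.
  have xc' : x i != c by rewrite gt_eqF.
  by case: (ext _ x1 ex xc') => -[] //; lra.
have uz : uniq (map z (iota 1 k2)).
  by apply: (increasing_upto_uniq zn (iota_uniq _ _)) => i; rewrite mem_iota; nat_lia.
have ux : uniq (map x (iota k1.+2 (n - k1))).
  by apply: (increasing_upto_uniq xn (iota_uniq _ _)) => i; rewrite mem_iota; nat_lia.
have us : uniq s.
  rewrite cat_uniq uz ux andbT /=; apply/hasPn => y /sr[cy _].
  by apply/negP => /sl[yc _]; lra.
have [|] := deriv_level_count (c := c) n0 sq nf us.
  by move=> y; rewrite mem_cat => /orP[/sl|/sr]; [left|right].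
by move=> + _; rewrite size_cat !size_map !size_iota; nat_lia.
Qed.

Lemma corner_index_inj k1 k2 c : (k1 < n)%N -> (k2 < n)%N ->
  corner n k1 c -> corner n k2 c -> k1 = k2.
Proof.
move=> k1n k2n cor1 cor2; have [k12|k12|//] := ltngtP k1 k2.
  by case: (corner_index_lt k12 k2n cor1 cor2).
by case: (corner_index_lt k12 k1n cor2 cor1).
Qed.

(* A corner rescaled so that the kink is at [0] and the error is [1]. *)
Definition snake k a b q x :=
  [/\ (size q <= n.+1)%N, bounded_err 0 q 1 a b, increasing_upto x n.+2 &
   [/\ x 0%N = a, x n.+2 = b, x k.+1 = 0 & alternates 0 q 1 x n.+2 k]].

Lemma corner_snake k c : corner n k c -> exists h q x,
  0 < h /\ snake k ((-1 - c) / h) ((1 - c) / h) q x.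
Proof.
move=> [q [h [x [sq h0 bd xn [xl xr xk alt]]]]].
pose q' := h^-1 *: (q \Po (h *: 'X + c%:P)).
have errE y : err 0 q' y = err c q (h * y + c) / h.
  rewrite /err /fabs hornerZ horner_comp hornerD hornerZ hornerX hornerC subr0 addrK normrM gtr0_norm //.
  by field; rewrite gt_eqF.
have hK y : h * ((y - c) / h) + c = y by field; rewrite gt_eqF.
exists h, q', (fun i => (x i - c) / h); split=> //; split.
- by apply: leq_trans (size_scale_leq _ _) _; apply: leq_trans (size_comp_affine _ _ _) sq.
- move=> y; rewrite ler_pdivrMr // ler_pdivlMr // => y1.
  rewrite errE normrM normfV (gtr0_norm h0) ler_pdivrMr // mul1r; apply: bd; lra.
- by move=> i iN; rewrite ltr_pM2r ?invr_gt0 // ltrD2r; exact: xn.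
split; rewrite ?xl ?xr ?xk ?subrr ?mul0r // => i iN.
by rewrite errE hK alt // mulfK ?mulr1 // gt_eqF.
Qed.

(** With a common kink, [|x|] cancels in the difference of the errors. Either the second interval
    lies in the first and [alternation_unique] applies, or the intervals are staggered and each
    error dominates on one side of the kink. *)
Lemma snake_poly_eq_le k a1 b1 q1 x1 a2 b2 q2 x2 : (k < n)%N -> a1 <= a2 ->
  snake k a1 b1 q1 x1 -> snake k a2 b2 q2 x2 -> q1 = q2.
Proof.
move=> kn a12 [sq1 bd1 xn1 [xl1 xr1 xk1 alt1]] [sq2 bd2 xn2 [xl2 xr2 xk2 alt2]].
have a20 : a2 < 0 by rewrite -xl2 -xk2; apply: (increasing_upto_lt xn2); nat_lia.
have b10 : 0 < b1 by rewrite -xr1 -xk1; apply: (increasing_upto_lt xn1); nat_lia.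
have [b21|b12] := leP b2 b1.
  apply: (alternation_unique sq2 sq1 (increasing_upto_leq (leqnSn _) xn2)
    (alternates_leq (leqnSn _) alt2)) => i iN; apply: bd1; apply/andP; split.
    by apply: le_trans a12 _; rewrite -xl2; apply: (increasing_upto_le xn2); nat_lia.
  by apply: le_trans b21; rewrite -xr2; apply: (increasing_upto_le xn2); nat_lia.
(* To the left of the kink use the extremal points of [q2], to the right those
   of [q1]: the kink itself can be skipped. *)
pose y i := if (i <= k)%N then x2 i else x1 i.+1.
have yn : increasing_upto y n.+1.
  move=> i iN; rewrite /y; case: (ltngtP i k) => ik.
  - by apply: xn2; nat_lia.
  - by apply: xn1; nat_lia.
  - apply: (@lt_trans _ _ 0); first by rewrite -xk2 -ik; apply: xn2; nat_lia.
    by rewrite -xk1 -ik; apply: xn1; nat_lia.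
apply/eqP; rewrite -subr_eq0; apply/eqP.
suff : (-1) ^+ k *: (q1 - q2) = 0.
  by move/eqP; rewrite scaler_eq0 signr_eq0 /= => /eqP.
apply: (weak_alternation yn) => [i iN|]; last first.
  apply: leq_trans (size_scale_leq _ _) _; apply: leq_trans (size_polyD _ _) _.
  by rewrite size_polyN geq_max sq1.
rewrite hornerZ mulrA -exprD hornerD hornerN /y; case: (leqP i k) => ik.
  have -> : q1.[x2 i] - q2.[x2 i] = (-1) ^+ (i + k) - err 0 q1 (x2 i).
    have := alt2 i (leqW iN); rewrite mulr1 => <-.
    by rewrite /err; ring.
  rewrite mulrBr -expr2 sqrr_sign subr_ge0; apply: le_trans (ler_norm _) _.
  rewrite normrM normr_sign mul1r; apply: bd1; apply/andP; split.
    by apply: le_trans a12 _; rewrite -xl2; apply: (increasing_upto_le xn2); nat_lia.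
  apply/ltW; apply: lt_trans b10; rewrite -xk2.
  by apply: (increasing_upto_lt xn2); nat_lia.
(* Skipping the kink and exchanging the roles of [q1] and [q2] each flip the sign, so the pattern
   continues. *)
have -> : q1.[x1 i.+1] - q2.[x1 i.+1] = (-1) ^+ (i + k) + err 0 q2 (x1 i.+1).
  have := alt1 i.+1 iN; rewrite mulr1 addSn exprS mulN1r => /eqP.
  by rewrite -eqr_oppLR => /eqP <-; rewrite /err; ring.
rewrite mulrDr -expr2 sqrr_sign -lerBlDl sub0r lerNl; apply: le_trans (ler_norm _) _.
rewrite normrN normrM normr_sign mul1r; apply: bd2; apply/andP; split.
  apply/ltW; apply: lt_trans a20 _; rewrite -xk1.
  by apply: (increasing_upto_lt xn1); nat_lia.
by apply/(le_trans _ (ltW b12)); rewrite -xr1; apply: (increasing_upto_le xn1); nat_lia.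
Qed.

(** The common error is bounded by 1 on the union of the intervals. If the first reached beyond an
    end of the second, all but one of the [n + 3] points of the second would be interior to the
    union, one more than [extremal_count] allows. *)
Lemma snake_ends k a1 b1 x1 a2 b2 x2 q : (k < n)%N ->
  snake k a1 b1 q x1 -> snake k a2 b2 q x2 -> a2 <= a1 /\ b1 <= b2.
Proof.
move=> kn [sq bd1 xn1 [xl1 xr1 xk1 alt1]] [_ bd2 xn2 [xl2 xr2 xk2 alt2]].
have n0 : (0 < n)%N by nat_lia.
have nf := alternates_not_flat ltr01 (isT : (1 < n.+2)%N) xn1 alt1.
have a20 : a2 < 0 by rewrite -xl2 -xk2; apply: (increasing_upto_lt xn2); nat_lia.
have b10 : 0 < b1 by rewrite -xr1 -xk1; apply: (increasing_upto_lt xn1); nat_lia.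
have a10 : a1 < 0 by rewrite -xl1 -xk1; apply: (increasing_upto_lt xn1); nat_lia.
have b20 : 0 < b2 by rewrite -xr2 -xk2; apply: (increasing_upto_lt xn2); nat_lia.
have bd : bounded_err 0 q 1 (Num.min a1 a2) (Num.max b1 b2).
  move=> y; rewrite ge_min le_max => /andP[/orP[] ya /orP[] yb].
  - by apply: bd1; rewrite ya.
  - have [y0|y0] := leP y 0; first by apply: bd1; rewrite ya (le_trans y0 (ltW b10)).
    by apply: bd2; rewrite yb (le_trans (ltW a20) (ltW y0)).
  - have [y0|y0] := leP y 0; first by apply: bd2; rewrite ya (le_trans y0 (ltW b20)).
    by apply: bd1; rewrite yb (le_trans (ltW a10) (ltW y0)).
  - by apply: bd2; rewrite ya.
have sgn i j : `|(-1) ^+ (i + j) * 1| = 1 :> R by rewrite mulr1 normr_sign.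
split; rewrite leNgt; apply/negP => lt12.
  have us : uniq (map x2 (iota 0 n.+2)).
    by apply: (increasing_upto_uniq xn2 (iota_uniq _ _)) => i; rewrite mem_iota; nat_lia.
  have [|] := extremal_count n0 sq nf bd us; last by rewrite size_map size_iota ltnn.
  move=> w /mapP[i]; rewrite mem_iota => iN ->; split; last by rewrite alt2 //; nat_lia.
  rewrite gt_min lt_max; apply/andP; split; apply/orP; [left|right].
    by apply: lt_le_trans lt12 _; rewrite -xl2; apply: (increasing_upto_le xn2); nat_lia.
  by rewrite -xr2; apply: (increasing_upto_lt xn2); nat_lia.
have us : uniq (map x2 (iota 1 n.+2)).
  by apply: (increasing_upto_uniq xn2 (iota_uniq _ _)) => i; rewrite mem_iota; nat_lia.
have [|] := extremal_count n0 sq nf bd us; last by rewrite size_map size_iota ltnn.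
move=> w /mapP[i]; rewrite mem_iota => iN ->; split; last by rewrite alt2 //; nat_lia.
rewrite gt_min lt_max; apply/andP; split; apply/orP; [right|left].
  by rewrite -xl2; apply: (increasing_upto_lt xn2); nat_lia.
by apply: le_lt_trans lt12; rewrite -xr2; apply: (increasing_upto_le xn2); nat_lia.
Qed.

Lemma corner_unique k c1 c2 : (k < n)%N -> corner n k c1 -> corner n k c2 ->
  c1 = c2.
Proof.
move=> kn /corner_snake[h1 [q1 [x1 [h10 s1]]]] /corner_snake[h2 [q2 [x2 [h20 s2]]]].
have qq : q1 = q2.
  have [a12|/ltW a21] := leP ((-1 - c1) / h1) ((-1 - c2) / h2).
    exact: snake_poly_eq_le a12 s1 s2.
  by apply/esym; exact: snake_poly_eq_le a21 s2 s1.
rewrite qq in s1.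
have [a12 b12] := snake_ends kn s1 s2; have [a21 b21] := snake_ends kn s2 s1.
have aE : (-1 - c1) / h1 = (-1 - c2) / h2 by apply/eqP; rewrite eq_le a12 a21.
have bE : (1 - c1) / h1 = (1 - c2) / h2 by apply/eqP; rewrite eq_le b12 b21.
(* The rescaled intervals have lengths [2 / h1] and [2 / h2]. *)
have hE : h1^-1 = h2^-1 by lra.
move: bE; rewrite hE => /mulIf; rewrite invr_eq0 (gt_eqF h20) => /(_ isT); lra.
Qed.

End Corners.

(** * Existence of corners *)

Section Existence.
Variables (R : realType) (n : nat).
Implicit Types (p q d : {poly R}) (x : nat -> R) (a b c h y z eta : R).

Lemma horner_bound p : exists2 M, 0 <= M &
  forall y, -1 <= y <= 1 -> `|p.[y]| <= M.
Proof.
exists (\sum_(i < size p) `|p`_i|); first exact: sumr_ge0.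
move=> y y1; rewrite horner_coef; apply: le_trans (ler_norm_sum _ _ _) _.
apply: ler_sum => i _; rewrite normrM normrX ler_piMr // exprn_ile1 //.
by rewrite ler_norml.
Qed.

(** A Markov inequality with an unspecified constant, obtained by differentiating Lagrange's
    interpolation formula. *)
Lemma markov_bound : exists2 M : R, 0 < M & forall d (e : R),
  (size d <= n.+1)%N -> (forall y, -1 <= y <= 1 -> `|d.[y]| <= e) ->
  forall y, -1 <= y <= 1 -> `|d^`().[y]| <= M * e.
Proof.
have /choice[M MP] (i : 'I_n.+1) : exists M, 0 <= M /\
    forall y, -1 <= y <= 1 -> `|(basis R i)^`().[y]| <= M.
  by have [M M0 MP] := horner_bound (basis R i)^`(); exists M.
have M0 : 0 <= \sum_i M i by apply: sumr_ge0 => i _; have [] := MP i.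
exists (\sum_i M i + 1) => [|d e sd de y y1]; first lra.
have e0 : 0 <= e by apply: le_trans (de 0 _) => //; lra.
have -> : d^`().[y] = \sum_(i < n.+1) d.[node R n i] * (basis R i)^`().[y].
  rewrite -{1}(interpK sd) raddf_sum horner_sum; apply: eq_bigr => i _.
  by rewrite /= mxE mul_polyC derivZ hornerZ.
apply: le_trans (ler_norm_sum _ _ _) _.
apply: le_trans (_ : \sum_i M i * e <= _); last by rewrite -mulr_suml; nra.
apply: ler_sum => i _; have [Mi MiP] := MP i.
by rewrite normrM mulrC ler_pM // ?MiP // de // node_bound.
Qed.

(** The kink has index [j], and the error there is [- En n c], whence the offset [j.+1]. *)
Definition alternation_at j c := exists q x,
  [/\ (size q <= n.+1)%N, bounded_err c q (En n c) (-1) 1,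
      increasing_upto x n.+1 &
      [/\ -1 <= x 0%N, x n.+1 <= 1, x j = c &
          alternates c q (En n c) x n.+1 j.+1]].

Lemma alternation_at_exists c : (0 < n)%N -> -1 < c < 1 ->
  exists2 j, (j <= n.+1)%N & alternation_at j c.
Proof.
move=> n0 c1; have c1' : -1 <= c <= 1 by lra.
have [q sq bd] := En_attained n c1'.
have [x [k [xn xl xr alt]]] := alternation_exists n0 c1 sq bd.
have [j [jn xj alt']] := alternates_index n0 sq (En_gt0 n c1) c1 bd xn xl xr alt.
by exists j => //; exists q, x; split.
Qed.

(** Keeping the same [q] while moving [c] shows that [En n] is 1-Lipschitz. *)
Lemma En_continuous : continuous (En n : R -> R).
Proof.
have le c c' : En n c - `|c - c'| <= En n c'.
  apply: En_ge => q h sq bd; rewrite lerBlDr; apply: (En_le sq) => y y1.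
  have := bd y y1; rewrite /err /fabs => bdy.
  have -> : `|y - c| - q.[y] = (`|y - c'| - q.[y]) + (`|y - c| - `|y - c'|) by ring.
  apply: le_trans (ler_normD _ _) _; apply: lerD => //.
  apply: le_trans (ler_dist_dist _ _) _; rewrite distrC.
  by have -> : y - c' - (y - c) = c - c' by ring.
move=> c; apply/cvgrPdist_le => eps eps0; apply/nbhs_ballP; exists eps => //= c'.
rewrite /ball /= => cc; rewrite ler_norml.
have := le c c'; have := le c' c; rewrite (distrC c' c); move: cc.
by move=> h1 h2 h3; apply/andP; split; lra.
Qed.

(** The set is the projection of a compact set of triples of [c], samples of [q] and alternation
    points, in which the points are only weakly ordered. The margin [eta] keeps [En n c] positive,
    which restores strictness. *)
Lemma alternation_at_closed j eta : (j <= n.+1)%N -> 0 < eta ->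
  closed [set c | -1 + eta <= c <= 1 - eta /\ alternation_at j c].
Proof.
move=> jn eta0.
pose T := ((R * 'rV[R]_n.+1) * 'rV[R]_n.+2)%type.
pose fc (t : T) : R := t.1.1.
pose fv (t : T) : 'rV[R]_n.+1 := t.1.2.
pose fx i (t : T) : R := t.2 ord0 (inord i).
have cc : continuous fc.
  by move=> t; apply: (@cvg_comp _ _ _ fst fst _ (nbhs t.1)); exact: cvg_fst.
have cv : continuous fv.
  by move=> t; apply: (@cvg_comp _ _ _ fst snd _ (nbhs t.1)); [exact: cvg_fst|exact: cvg_snd].
have cx i : continuous (fx i).
  move=> t; apply: (@cvg_comp _ _ _ snd (fun M : 'rV[R]_n.+2 => M ord0 (inord i)) _ (nbhs t.2)).
    exact: cvg_snd.
  exact: coord_continuous.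
have cE : continuous (fun t => En n (fc t)).
  by move=> t; apply: (@cvg_comp _ _ _ fc (En n)); [exact: cc|exact: En_continuous].
pose A : set T := (`[-1 + eta, 1 - eta]%classic `*` box (-4) 4) `*` box (-1) 1.
pose B : set T :=
  [set t | bounded_err (fc t) (interp (fv t)) (En n (fc t)) (-1) 1] `&`
  ([set t | forall i, (i < n.+1)%N -> fx i t <= fx i.+1 t] `&`
  ([set t | fx j t = fc t] `&`
   [set t | forall i, (i <= n.+1)%N ->
     err (fc t) (interp (fv t)) (fx i t) = (-1) ^+ (i + j.+1) * En n (fc t)])).
have cB : closed B.
  apply: closedI; first exact: closed_bounded_err.
  apply: closedI.
    apply: (@closed_bigI _ _ [set i | (i < n.+1)%N] (fun i => [set t | fx i t <= fx i.+1 t])).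
    by move=> i _; exact: closed_le_fun.
  apply: closedI; first exact: closed_eq_fun.
  apply: (@closed_bigI _ _ [set i | (i <= n.+1)%N] (fun i => [set t |
    err (fc t) (interp (fv t)) (fx i t) = (-1) ^+ (i + j.+1) * En n (fc t)])).
  move=> i _; apply: closed_eq_fun; first exact: err_interp_continuous.
  by move=> t; apply: cvgM; [exact: cvg_cst|exact: cE].
have cA : compact (A `&` B).
  apply: compact_closedI => //; apply: compact_setX; last exact: box_compact.
  by apply: compact_setX; [exact: segment_compact|exact: box_compact].
have -> : [set c | -1 + eta <= c <= 1 - eta /\ alternation_at j c] = fc @` (A `&` B).
  apply/seteqP; split=> [c [c1 [q [x [sq bd xn [xl xr xj alt]]]]]|c0 [t [[[tc vb] xb] [bd [xle [xj alt]]]] <-]].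
    have xE i : (i <= n.+1)%N ->
        fx i ((c, \row_(i < n.+1) q.[node R n i]), \row_(i < n.+2) x i) = x i.
      by move=> iN; rewrite /fx /= mxE inordK.
    exists ((c, \row_(i < n.+1) q.[node R n i]), \row_(i < n.+2) x i) => //.
    have c1' : -1 <= c <= 1 by lra.
    split; first split => /=.
    - split=> /=; first by rewrite in_itv.
      exact: sample_box (En_le2 n c1') bd.
    - move=> i; rewrite mxE /= in_itv /=.
      have iN : (i <= n.+1)%N by rewrite -ltnS.
      rewrite (le_trans xl) ?(increasing_upto_le xn) //=.
      by apply: le_trans xr; rewrite (increasing_upto_le xn).
    split; first by rewrite /= /fc /fv /= interpK.
    split; first by move=> i iN; rewrite !xE //; [exact/ltW/xn|exact: ltnW].
    split; first by rewrite /= xE.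
    by move=> i iN; rewrite xE // /fc /fv /= interpK // alt.
  have c1 : -1 + eta <= fc t <= 1 - eta by move: tc; rewrite /= in_itv.
  have c1' : -1 < fc t < 1 by lra.
  have h0 := En_gt0 n c1'.
  split; first exact: c1.
  exists (interp (fv t)), (fun i => fx i t); split=> //; first exact: size_interp.
    (* Coinciding neighbours would have opposite nonzero errors. *)
    move=> i iN; rewrite lt_neqAle xle // andbT; apply/eqP => xx.
    have := alt i.+1 iN; rewrite -xx alt ?(ltnW iN) // addSn exprS.
    have : (-1) ^+ (i + j.+1) != 0 :> R by rewrite signr_eq0.
    move: ((-1) ^+ _) => u u0 E.
    have /eqP : u * En n (fc t) = 0 by clear - E; lra.
    by rewrite mulf_eq0 (negbTE u0) (gt_eqF h0).
  by split=> //; [have := xb (inord 0)|have := xb (inord n.+1)];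
    rewrite /= in_itv /= => /andP[].
apply: compact_closed; first exact: Rhausdorff.
by apply: continuous_compact cA; exact: continuous_subspaceT.
Qed.

(** For [c] near -1 the function is nearly a line of slope 1, so by [markov_bound] the derivative of
    [q] never equals -1 and no interior extremal point lies left of [c]. Near 1 the situation is
    reflected. *)
Lemma alternation_at_ends : (0 < n)%N -> exists2 eta, 0 < eta < 1 &
  (forall j, (j <= n.+1)%N -> alternation_at j (-1 + eta) -> (j <= 1)%N) /\
  (forall j, (j <= n.+1)%N -> alternation_at j (1 - eta) -> (n <= j)%N).
Proof.
move=> n0; have [M M0 MP] := markov_bound.
(* Chosen so that [M * (3 * eta) < 2], where [3 * eta] adds the distance [2 * eta] from the function
   to the line and the error [eta]. *)
pose eta := (3 * M + 2)^-1; have e0 : 0 < eta by rewrite invr_gt0; lra.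
have eM : eta * (3 * M + 2) = 1 by rewrite mulVf // gt_eqF //; lra.
have e1 : eta < 1 by nra.
exists eta; first by rewrite e0 e1.
have line_size a b : (size (a *: 'X + b%:P : {poly R})%R <= n.+1)%N.
  apply: leq_trans (size_polyD _ _) _; rewrite geq_max.
  rewrite (leq_trans (size_scale_leq _ _)) ?size_polyX //=.
  exact: leq_trans (size_polyC_leq1 _) _.
have line_deriv a b : (a *: 'X + b%:P)^`() = a%:P :> {poly R}.
  by rewrite derivD derivZ derivX derivC addr0 alg_polyC.
have near_line q c a b y : (size q <= n.+1)%N ->
    bounded_err c q eta (-1) 1 ->
    (forall z, -1 <= z <= 1 -> `| `|z - c| - (a * z + b) | <= 2 * eta) ->
    -1 <= y <= 1 -> `|q^`().[y] - a| < 2.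
  move=> sq bd ln y1.
  have := MP (q - (a *: 'X + b%:P)) (3 * eta) _ _ y y1.
  rewrite derivB line_deriv hornerD hornerN hornerC => H.
  apply: le_lt_trans (H _ _) _; [| |nra].
    by apply: leq_trans (size_polyD _ _) _; rewrite size_polyN geq_max sq line_size.
  move=> z z1; rewrite hornerD hornerN hornerD hornerZ hornerX hornerC.
  have -> : q.[z] - (a * z + b) = (`|z - c| - (a * z + b)) - (`|z - c| - q.[z]) by ring.
  apply: le_trans (ler_normB _ _) _.
  by have := ln z z1; have := bd z z1; rewrite /err /fabs; lra.
split=> j jn [q [x [sq bd xn [xl xr xj alt]]]].
  set c := -1 + eta in bd xj alt *; have c1 : -1 < c < 1 by rewrite /c; lra.
  have c1' : -1 <= c <= 1 by lra.
  have ce : En n c <= eta.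
    by apply: le_trans (En_le_chord n0 c1') _; rewrite /c; nra.
  have bd' : bounded_err c q eta (-1) 1 by move=> y /bd/le_trans; apply.
  rewrite leqNgt; apply/negP => j2.
  have x1c : x 1%N < c by rewrite -xj; apply: (increasing_upto_lt xn).
  have x11 : -1 < x 1%N by apply: le_lt_trans xl _; exact: xn.
  have ex : `|err c q (x 1%N)| = En n c.
    by rewrite alt // normrM normr_sign mul1r gtr0_norm // En_gt0.
  have x1in : -1 < x 1%N < 1 by lra.
  have := extremal_left bd x1in x1c ex.
  have := near_line q c 1 (- c) (x 1%N) sq bd' _ _; move=> H dq.
  have : `|q^`().[x 1%N] - 1| < 2.
    apply: H; last lra.
    move=> z z1; rewrite mul1r; have [zc|zc] := leP 0 (z - c).
      by rewrite (ger0_norm zc) subrr normr0; lra.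
    by rewrite (ltr0_norm zc) ler_norml; move: z1 zc; rewrite /c; clear; lra.
  by rewrite dq ltr_norml; lra.
set c := 1 - eta in bd xj alt *; have c1 : -1 < c < 1 by rewrite /c; lra.
have c1' : -1 <= c <= 1 by lra.
have ce : En n c <= eta.
  by apply: le_trans (En_le_chord n0 c1') _; rewrite /c; nra.
have bd' : bounded_err c q eta (-1) 1 by move=> y /bd/le_trans; apply.
rewrite leqNgt; apply/negP => j2.
have x1c : c < x n by rewrite -xj; apply: (increasing_upto_lt xn).
have x11 : x n < 1 by apply: lt_le_trans xr; exact: xn.
have ex : `|err c q (x n)| = En n c.
  by rewrite alt // normrM normr_sign mul1r gtr0_norm // En_gt0.
have x1in : -1 < x n < 1 by lra.
have := extremal_right bd x1in x1c ex.
have := near_line q c (-1) c (x n) sq bd' _ _; move=> H dq.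
have : `|q^`().[x n] - -1| < 2.
  apply: H; last lra.
  move=> z z1; rewrite mulN1r; have [zc|zc] := leP 0 (z - c).
    by rewrite (ger0_norm zc) ler_norml; move: z1 zc; rewrite /c; clear; lra.
  by rewrite (ltr0_norm zc) ler_norml; lra.
by rewrite dq ltr_norml; lra.
Qed.

(** By uniqueness both alternations belong to one error function. The last [k + 1] points before [c]
    in the second, [c] itself and the first [n + 1 - k] points after [c] in the first are [n + 3]
    extremal points. *)
Lemma alternation_at_merge j j' k c : (0 < k < n)%N -> -1 < c < 1 ->
  (j <= k)%N -> (k < j' <= n.+1)%N -> alternation_at j c -> alternation_at j' c ->
  corner n k c.
Proof.
move=> kn c1 jk kj' [q [x [sq bd xn [xl xr xj alt]]]].
move=> [q' [y [sq' bd' yn [yl yr yj alt']]]].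
have h0 := En_gt0 n c1; have n0 : (0 < n)%N by nat_lia.
have qq : q' = q.
  apply: (alternation_unique sq sq' xn alt) => i iN; apply: bd'; apply/andP; split.
    by apply: le_trans xl _; apply: (increasing_upto_le xn).
  by apply: le_trans _ xr; apply: (increasing_upto_le xn).
rewrite {}qq in bd' sq' alt'.
have nf := alternates_not_flat h0 (n0 : (1 < n.+1)%N) xn alt.
have ex i : (i <= n.+1)%N -> `|err c q (x i)| = En n c.
  by move=> iN; rewrite alt // normrM normr_sign mul1r gtr0_norm.
have ey i : (i <= n.+1)%N -> `|err c q (y i)| = En n c.
  by move=> iN; rewrite alt' // normrM normr_sign mul1r gtr0_norm.
pose w i := if (i <= k.+1)%N then y (j' - k.+1 + i)%N else x (i - k.+1 + j)%N.
have wn : increasing_upto w n.+2.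
  move=> i iN; rewrite /w; case: (ltngtP i k.+1) => ik.
  - by rewrite addnS; apply: yn; nat_lia.
  - by rewrite subSn ?addSn; [apply: xn|]; nat_lia.
  - rewrite ik subnK; last nat_lia.
    rewrite yj -xj subSn // subnn add1n; apply: xn; nat_lia.
have wl : -1 <= w 0%N.
  by rewrite /w /=; apply: le_trans yl _; apply: (increasing_upto_le yn); nat_lia.
have wr : w n.+2 <= 1.
  rewrite /w ifN; last by rewrite -ltnNge; nat_lia.
  by apply: le_trans _ xr; apply: (increasing_upto_le xn); nat_lia.
have we i : (i <= n.+2)%N -> `|err c q (w i)| = En n c.
  by move=> iN; rewrite /w; case: leqP => ik; [apply: ey|apply: ex]; nat_lia.
have wk : w k.+1 = c by rewrite /w leqnn subnK ?yj //; nat_lia.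
have [k' [kn' w0 w2 wk' walt]] :=
  extremal_points_corner n0 sq nf h0 c1 bd wn wl wr we.
suff kk : k' = k.
  by rewrite kk in walt; exists q, (En n c), w; split.
have [lt|lt|//] := ltngtP k' k.
  by have := increasing_upto_lt wn (lt : (k'.+1 < k.+1)%N) ltac:(nat_lia); rewrite wk wk' ltxx.
by have := increasing_upto_lt wn (lt : (k.+1 < k'.+1)%N) ltac:(nat_lia); rewrite wk wk' ltxx.
Qed.

(** Without a corner, the closed sets [L] and [U] would be disjoint by [alternation_at_merge] and
    would disconnect a segment. *)
Lemma corner_exists k : (0 < k < n)%N -> exists c : R, corner n k c.
Proof.
move=> kn; have n0 : (0 < n)%N by nat_lia.
apply: contrapT => nex; have [eta eta1 [lend rend]] := alternation_at_ends n0.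
pose S j := [set c | -1 + eta <= c <= 1 - eta /\ alternation_at j c].
pose L := \bigcup_(j in `I_k.+1) S j.
pose U := \bigcup_(j in [set j | (k < j <= n.+1)%N]) S j.
have cS j : (j <= n.+1)%N -> closed (S j).
  by move=> jn; apply: alternation_at_closed => //; lra.
have cL : closed L.
  by apply: closed_bigcup => // j /= jk; apply: cS; nat_lia.
have cU : closed U.
  apply: closed_bigcup => [|j /andP[_ jn]]; last exact: cS.
  apply: (@sub_finite_set _ _ `I_n.+2) => //.
  by move=> j /= /andP[].
have LU c : L c -> U c -> False.
  move=> [j jk [cin aj]] [j' kj' [_ aj']]; apply: nex; exists c.
  by apply: alternation_at_merge aj aj' => //; lra.
have cov c : -1 + eta <= c <= 1 - eta -> L c \/ U c.
  move=> cin; have [j jn aj] := alternation_at_exists (c := c) n0 ltac:(lra).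
  have [jk|jk] := leqP j k; [left|right]; exists j => //=; nat_lia.
have inI c : `[-1 + eta, 1 - eta]%classic c <-> -1 + eta <= c <= 1 - eta.
  by rewrite /= in_itv.
(* At the left end every index is at most 1, hence at most [k]; at the right end it is at least [n],
   hence above [k]. *)
have Ll : L (-1 + eta).
  have lin : -1 + eta <= -1 + eta <= 1 - eta by lra.
  case: (cov _ lin) => // -[j /andP[kj jn] [_ aj]].
  by have := lend j jn aj; nat_lia.
have Uu : U (1 - eta).
  have rin : -1 + eta <= 1 - eta <= 1 - eta by lra.
  case: (cov _ rin) => // -[j /= jk [_ aj]].
  have jn : (j <= n.+1)%N by nat_lia.
  by have := rend j jn aj; nat_lia.
have eqI : `[-1 + eta, 1 - eta]%classic `&` L = `[-1 + eta, 1 - eta]%classic.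
  apply: (@segment_connected R (-1 + eta) (1 - eta)).
  - by exists (-1 + eta); split=> //; apply/inI; lra.
  - exists (~` U); first exact: closed_openC.
    apply/seteqP; split=> c [/inI cin].
      by move=> Lc; split; [exact/inI|move=> Uc; exact: LU Lc Uc].
    by move=> Uc; split; [exact/inI|case: (cov c cin)].
  - by exists L.
have : (`[-1 + eta, 1 - eta]%classic `&` L) (1 - eta) by rewrite eqI; apply/inI; lra.
by case=> _ Lu; exact: LU Lu Uu.
Qed.

End Existence.

(** * Counting the V-shapes *)

Section VShapeCount.
Variables (R : realType) (n : nat).
Implicit Types (a b c y : R).

(** [has_vshape_on] with the vertex exposed, so that vertices can be compared with corners. *)
Definition vshape_at a b c :=
  (-1 <= a /\ b <= 1) /\
  [/\ c \in `]a, b[, {within `[a, b], continuous (En n : R -> R)},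
      affine_on (En n) a c /\ decreasing_on (En n) a c &
      affine_on (En n) c b /\ increasing_on (En n) c b].

(** The slopes [m1 < 0 < m2] make [c] a sharp minimum, with the smaller of [- m1] and [m2] as
    rate. *)
Lemma vshape_at_corner a b c : (0 < n)%N -> vshape_at a b c ->
  exists2 k, (0 < k < n)%N & corner n k c.
Proof.
move=> n0 [[a1 b1] [+ _ [[m1 [k1 E1]] dec] [[m2 [k2 E2]] inc]]].
rewrite in_itv /= => /andP[ac cb].
have Ea : En n c < En n a by apply: dec; rewrite ?in_itv /= ?lexx ?(ltW ac).
have Eb : En n c < En n b by apply: inc; rewrite ?in_itv /= ?lexx ?(ltW cb).
have m1_lt0 : m1 < 0.
  by move: Ea; rewrite !E1 ?in_itv /= ?lexx ?(ltW ac) //; nra.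
have m2_gt0 : 0 < m2.
  by move: Eb; rewrite !E2 ?in_itv /= ?lexx ?(ltW cb) //; nra.
apply: (@sharp_min_corner R n c (Num.min (- m1) m2) (Num.min (c - a) (b - c)) n0).
- by apply/andP; split; lra.
- by rewrite lt_min oppr_gt0 m1_lt0.
- by rewrite lt_min !subr_gt0 ac.
move=> t; rewrite lt_min => /andP[ta tb].
have [t0|t0] := leP 0 t.
  rewrite (ger0_norm t0) in tb *.
  rewrite !E2 ?in_itv /=; [|apply/andP; split; lra|apply/andP; split; lra].
  have : Num.min (- m1) m2 <= m2 by rewrite ge_min lexx orbT.
  by move=> /(ler_wpM2r t0); lra.
rewrite (ltr0_norm t0) in ta *.
rewrite !E1 ?in_itv /=; [|apply/andP; split; lra|apply/andP; split; lra].
have nt : 0 <= - t by lra.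
have : Num.min (- m1) m2 <= - m1 by rewrite ge_min lexx.
by move=> /(ler_wpM2r nt); lra.
Qed.

(** Between two distinct vertices [En n] would both increase and decrease on a common segment. *)
Lemma vshape_center_le a b c a' b' c' : a' <= a -> b <= b' ->
  vshape_at a b c -> vshape_at a' b' c' -> c = c'.
Proof.
move=> aa bb [_ [+ _ [_ dec] [_ inc]]] [_ [+ _ [_ dec'] [_ inc']]].
rewrite !in_itv /= => /andP[ac cb] /andP[ac' cb'].
have [cc|cc|//] := ltgtP c c'.
  pose y := Num.min b c'.
  have yb : y <= b by rewrite ge_min lexx.
  have yc : y <= c' by rewrite ge_min lexx orbT.
  have cy : c < y by rewrite lt_min cb.
  have := inc c y; have := dec' c y; rewrite !in_itv /= lexx => d i.
  have {}i : En n c < En n y by apply: i; lra.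
  have {}d : En n y < En n c by apply: d; lra.
  by have := lt_trans i d; rewrite ltxx.
pose y := Num.max a c'.
have yb : a <= y by rewrite le_max lexx.
have yc : c' <= y by rewrite le_max lexx orbT.
have cy : y < c by rewrite gt_max ac.
have := dec y c; have := inc' y c; rewrite !in_itv /= lexx => d i.
have {}i : En n c < En n y by apply: i; lra.
have {}d : En n y < En n c by apply: d; lra.
by have := lt_trans i d; rewrite ltxx.
Qed.

(** The supremum of the admissible right ends is admissible because [Z] is closed. It serves to
    follow [En n] along a line as far as possible. *)
Lemma maximal_right (Z : set R) c u : closed Z ->
  (exists b, [/\ c < b, b <= u & forall y, c <= y <= b -> Z y]) ->
  exists b, [/\ c < b, b <= u, forall y, c <= y <= b -> Z y &
    forall b', c < b' -> b' <= u -> (forall y, c <= y <= b' -> Z y) -> b' <= b].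
Proof.
move=> cZ exb.
pose S := [set b | [/\ c < b, b <= u & forall y, c <= y <= b -> Z y]].
have S0 : S !=set0 by [].
have Su : has_ubound S by exists u => b -[].
have hs : has_sup S by [].
have le_sup b : S b -> b <= sup S by move=> Sb; apply: sup_upper_bound.
have [b0 [cb0 bu0 Zb0]] := exb.
have Sb0 : S b0 by split.
have cs : c < sup S by apply: lt_le_trans cb0 (le_sup _ Sb0).
exists (sup S); split=> //.
- by apply: ge_sup => // b [].
- move=> y /andP[cy]; rewrite le_eqVlt => /orP[/eqP->|ys]; last first.
    have [b [cb bu Zb] yb] := sup_gt S0 ys.
    by apply: Zb; rewrite cy (ltW yb).
  suff : closure Z (sup S) by rewrite -(closure_id Z).1.
  have : closure S (sup S) by apply: closure_sup.
  by apply: closure_subset => b [cb _]; apply; rewrite lexx (ltW cb).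
- by move=> b' cb' bu' Zb'; apply: le_sup.
Qed.

Lemma affine_closed (m k : R) : closed [set y | En n y = m * y + k].
Proof.
apply: closed_eq_fun => [|y]; first exact: En_continuous.
apply: cvgD; last exact: cvg_cst.
by apply: cvgM; [exact: cvg_cst|exact: cvg_id].
Qed.

Lemma affine_eq (m k m' k' a b y : R) : a < b -> m * a + k = m' * a + k' ->
  m * b + k = m' * b + k' -> m * y + k = m' * y + k'.
Proof.
move=> ab ea eb; have : (m - m') * (b - a) = 0 by lra.
move/eqP; rewrite mulf_eq0 (subr_eq0 b) (gt_eqF ab) orbF subr_eq0 => /eqP mm.
by rewrite mm in ea *; lra.
Qed.

(** The lines of [corner_lines] are followed as far as [En n] agrees with them. Every V-shape with
    vertex [c] lies on the same two lines near [c], hence stays within these limits. *)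
Lemma corner_vshape k c : (k < n)%N -> corner n k c -> exists a b,
  vshape_at a b c /\
  forall a' b', vshape_at a' b' c -> a <= a' /\ b' <= b.
Proof.
move=> kn cor; have c1 := corner_bounds kn cor; have E0 := En_gt0 n c1.
have [r r0 [Er El]] := corner_lines kn cor.
set mr := En n c / (1 + c) in Er; set ml := En n c / (1 - c) in El.
have mr0 : 0 < mr by rewrite divr_gt0 //; lra.
have ml0 : 0 < ml by rewrite divr_gt0 //; lra.
have [|b [cb b1 Zb bmax]] := maximal_right (c := c) (u := 1) (@affine_closed mr mr).
  exists (Num.min (c + r) 1); split.
  - by rewrite lt_min; apply/andP; split; lra.
  - by rewrite ge_min lexx orbT.
  - by move=> y /=; rewrite le_min => /and3P[y1 y2 _]; rewrite Er ?y1 //; lra.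
(* The left side is reflected through 0 to reuse [maximal_right]. *)
pose ZN := [set y | En n (- y) = (- ml) * (- y) + ml].
have cZN : closed ZN.
  apply: (@preimage_closed _ _ -%R [set y | En n y = (- ml) * y + ml]).
    by move=> y _; exact: opp_continuous.
  exact: affine_closed.
have [|a [ca a1 Za amax]] := maximal_right (c := - c) (u := 1) cZN.
  exists (Num.min (- c + r) 1); split.
  - by rewrite lt_min; apply/andP; split; lra.
  - by rewrite ge_min lexx orbT.
  - by move=> y /=; rewrite le_min => /and3P[y1 y2 _]; rewrite /ZN /= El; lra.
have Za' y : - a <= y <= c -> En n y = (- ml) * y + ml.
  by move=> y1; have := Za (- y); rewrite /ZN /= opprK; apply; lra.
have ac : - a < c by lra.
exists (- a), b; split.
  split; first by split; lra.
  split.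
  - by rewrite in_itv /= ac cb.
  - by apply: continuous_subspaceT; exact: En_continuous.
  - split; first by exists (- ml), ml => y; rewrite in_itv /=; exact: Za'.
    move=> y z; rewrite !in_itv /= => y1 z1 yz; rewrite !Za' //; nra.
  - split; first by exists mr, mr => y; rewrite in_itv /=; exact: Zb.
    move=> y z; rewrite !in_itv /= => y1 z1 yz; rewrite !(Zb _ _) //; nra.
move=> a' b' [[a1' b1'] [+ _ [[m1 [k1 E1]] _] [[m2 [k2 E2]] _]]].
rewrite in_itv /= => /andP[ac' cb']; split.
  rewrite lerNl; apply: amax; [lra|lra|].
  move=> y y1; rewrite /ZN /= E1 ?in_itv /=; last by apply/andP; split; lra.
  (* Both V-shapes cover [[z, c]], and two points determine the line. *)
  pose z := Num.max (- a) a'.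
  have z1 : - a <= z by rewrite le_max lexx.
  have z2 : a' <= z by rewrite le_max lexx orbT.
  have zc : z < c by rewrite gt_max ac.
  apply: (affine_eq _ zc).
    by rewrite -E1 ?Za' // ?in_itv /= ?z2 ?z1 ltW.
  by rewrite -E1 ?Za' // ?in_itv /= ?lexx ?(ltW ac) ?(ltW ac').
apply: bmax => // y y1; rewrite /= E2 ?in_itv //.
pose z := Num.min b b'.
have z1 : z <= b by rewrite ge_min lexx.
have z2 : z <= b' by rewrite ge_min lexx orbT.
have cz : c < z by rewrite lt_min cb.
apply: (affine_eq _ cz).
  by rewrite -E2 ?(Zb _ _) // ?in_itv /= ?lexx ?(ltW cb) ?(ltW cb').
by rewrite -E2 ?(Zb _ _) // ?in_itv /= ?z2 ?z1 ltW.
Qed.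

Lemma vshape_at_has a b c : vshape_at a b c -> has_vshape_on (En n) a b.
Proof. by move=> [ab H]; split=> //; exists c. Qed.

(** The V-shapes are enumerated by the corner index: [f i] is the largest V-shape at the corner of
    index [i.+1], as these indices run from 1 to [n - 1]. *)
Lemma vshapes_card : (0 < n)%N -> (vshapes (En n : R -> R) #= `I_(n - 1))%card.
Proof.
move=> n0.
have /choice[f fP] (i : nat) : exists p : R * R, (i < n - 1)%N -> exists c,
    [/\ corner n i.+1 c, vshape_at p.1 p.2 c &
        forall a b, vshape_at a b c -> p.1 <= a /\ b <= p.2].
  (* The pair [(0, 0)] is a default value outside the range. *)
  have [ik|ik] := ltnP i (n - 1); last by exists (0, 0).
  have ik' : (i.+1 < n)%N by nat_lia.
  have [c cor] := @corner_exists R n i.+1 ik'.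
  have [a [b [vab vmax]]] := corner_vshape ik' cor.
  by exists (a, b) => _; exists c; split.
have sub_itv a b a' b' c : vshape_at a b c ->
    `[a, b]%classic `<=` `[a', b']%classic -> a' <= a /\ b <= b'.
  move=> [_ [+ _ _ _]]; rewrite in_itv /= => /andP[ac cb] sub.
  have /= := sub a; have /= := sub b; rewrite !in_itv /= !lexx.
  rewrite (ltW (lt_trans ac cb)) /=.
  by move=> /(_ isT)/andP[_ ->] /(_ isT)/andP[->].
(* A larger V-shape has the same vertex, so maximality among V-shapes with that vertex is enough. *)
have fmax i : (i < n - 1)%N -> is_vshape (En n) (f i).1 (f i).2.
  move=> ik; have [c [cor v vmax]] := fP i ik; split; first exact: vshape_at_has v.
  move=> a' b' sub [ab' [c' v']].
  have [aa bb] := sub_itv _ _ _ _ _ v sub.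
  have v'' : vshape_at a' b' c' by [].
  have cc := vshape_center_le aa bb v v''; rewrite -cc in v''.
  have [aa' bb'] := vmax _ _ v''.
  by split; apply/eqP; rewrite eq_le ?aa ?aa' ?bb ?bb'.
have -> : vshapes (En n : R -> R) = f @` `I_(n - 1).
  apply/seteqP; split=> [[a b] /= [[ab [c v]] vmax]|_ [i ik <-]]; last exact: fmax.
  have {}v : vshape_at a b c by [].
  have [k kn cor] := vshape_at_corner n0 v.
  have kn1 : (k.-1 < n - 1)%N by nat_lia.
  have kk : k.-1.+1 = k by nat_lia.
  have [c' [cor' v' vmax']] := fP k.-1 kn1.
  rewrite kk in cor'.
  have kn' : (k < n)%N by nat_lia.
  rewrite (corner_unique kn' cor' cor) in v' vmax'.
  have [aa bb] := vmax' _ _ v.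
  exists k.-1 => //.
  have [|ea eb] := vmax _ _ _ (vshape_at_has v').
    by move=> y /=; rewrite !in_itv /= => /andP[y1 y2]; rewrite (le_trans aa) // (le_trans y2).
  by rewrite [LHS]surjective_pairing ea eb.
apply: inj_card_eq => i j; rewrite !inE /= => ik jk fij.
have [c [cor v _]] := fP i ik; have [c' [cor' v' _]] := fP j jk.
rewrite fij in v; have cc := vshape_center_le (lexx _) (lexx _) v v'.
rewrite cc in cor.
have in' : (i.+1 < n)%N by nat_lia.
have jn' : (j.+1 < n)%N by nat_lia.
by have [] := corner_index_inj in' jn' cor cor'.
Qed.

End VShapeCount.

Theorem theorem9 (R : realType) (n : nat) (hn : (0 < n)%N) :
  (vshapes (En (R := R) n) #= `I_(n - 1))%card.
Proof. exact: vshapes_card. Qed.
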